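(* Fix an even integer $k\ge 2$. For $n\ge1$, let $G_n=\mathrm{SL}_{2kn}(\mathbb{C})$ act on $V_n=\bigotimes^{2k}\mathbb{C}^{2kn}$ by $g\cdot(v_1\otimes\cdots\otimes v_{2k}) = (gv_1)\otimes\cdots\otimes(gv_{2k})$, extended linearly. Assume $\mathrm{VP}\neq\mathrm{VNP}$. Then there is no polynomial $q$ such that for every $n$ there exists a succinct encoding of a generating set of the invariant ring $\mathbb{C}[V_n]^{G_n}$ of size at most $q(n)$.
   Context: For a group $G$ acting linearly on $V=\mathbb{C}^m$ with coordinate variables $x_1,\dots,x_m$, the invariant ring $\mathbb{C}[V]^G$ consists of polynomials $f$ with $f(g\cdot v)=f(v)$ for all $g\in G$, $v\in V$. An arithmetic circuit $\mathcal{C}(x_1,\dots,x_m,y_1,\dots,y_r)$ (using only rational constants) succinctly encodes generators of $\mathbb{C}[V]^G$ if the set of polynomials $\{\mathcal{C}(x_1,\dots,x_m,\alpha_1,\dots,\alpha_r)\}_{\alpha\in\mathbb{C}^r}$ is a generating set of $\mathbb{C}[V]^G$ as a $\mathbb{C}$-algebra. The size of such an encoding is the number of gates plus the total bit complexity of the rational constants used. VP and VNP are Valiant's algebraic complexity classes. *)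

(* Defs.v *)
From HB Require Import structures.
From mathcomp Require Export all_boot all_order all_algebra.
From mathcomp Require Export reals complex.
From mathcomp Require Export mpoly.

Set Implicit Arguments.
Unset Strict Implicit.
Unset Printing Implicit Defensive.

Import GRing.Theory.
Local Open Scope ring_scope.

(* An arithmetic circuit is a DAG of fan-in two gates listed in topological
   order: the arguments of [GAdd] and [GMul] are positions of earlier gates,
   and the last gate is the output. *)
Inductive gate (K X : Type) : Type :=
  | GVar of X
  | GConst of K
  | GAdd of nat & nat
  | GMul of nat & nat.
Arguments GVar {K X}.
Arguments GConst {K X}.
Arguments GAdd {K X}.
Arguments GMul {K X}.

Definition gate_wf K X (pos : nat) (g : gate K X) : bool :=
  match g with
  | GVar _ | GConst _ => true
  | GAdd i j | GMul i j => (i < pos)%N && (j < pos)%N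
  end.

Fixpoint gates_wf K X (pos : nat) (s : seq (gate K X)) : bool :=
  if s is g :: s' then gate_wf pos g && gates_wf pos.+1 s' else true.

Record circuit (K X : Type) : Type := Circuit {
  gates : seq (gate K X);
  circuit_nonempty : (0 < size gates)%N;
  circuit_wf : gates_wf 0 gates
}.

Section Evaluation.
Variables (K X : Type) (A : nzRingType) (const : K -> A) (env : X -> A).

Definition gate_eval (vals : seq A) (g : gate K X) : A :=
  match g with
  | GVar x => env x
  | GConst c => const c
  | GAdd i j => vals`_i + vals`_j
  | GMul i j => vals`_i * vals`_j
  end.

Definition gate_values (s : seq (gate K X)) : seq A :=
  foldl (fun vals g => rcons vals (gate_eval vals g)) [::] s.

Definition circuit_eval (c : circuit K X) : A :=
  last 0 (gate_values (gates c)).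

End Evaluation.

Definition num_gates K X (c : circuit K X) : nat := size (gates c).

(* Number of binary digits of [n], with one digit for [n = 0]. *)
Definition bit_length (n : nat) : nat := (trunc_log 2 n).+1.

Definition rat_bits (a : rat) : nat :=
  (bit_length `|numq a| + bit_length `|denq a|)%N.

Definition gate_bits X (g : gate rat X) : nat :=
  if g is GConst a then rat_bits a else 0%N.

Definition encoding_size X (c : circuit rat X) : nat :=
  (num_gates c + \sum_(g <- gates c) gate_bits g)%N.

Definition p_bounded (t : nat -> nat) : Prop :=
  exists q : {poly nat}, forall n, (t n <= q.[n])%N.

Record poly_family (K : nzRingType) : Type := PolyFamily {
  nvars : nat -> nat;
  member :> forall n, {mpoly K[nvars n]}
}.

Definition computes (K : nzRingType) m
    (c : circuit K 'I_m) (f : {mpoly K[m]}) : Prop :=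
  circuit_eval (fun a => a%:MP) (fun i => 'X_i) c = f.

(* [msize f] is the total degree plus one for [f != 0]. *)
Definition VP (K : nzRingType) (f : poly_family K) : Prop :=
  [/\ p_bounded (nvars f),
      p_bounded (fun n => (msize (f n)).-1) &
      exists c : forall n, circuit K 'I_(nvars f n),
        p_bounded (fun n => num_gates (c n)) /\
        forall n, computes (c n) (f n)].

Definition subst_bits (K : nzRingType) m t (e : {ffun 'I_t -> bool})
    (g : {mpoly K[m + t]}) : {mpoly K[m]} :=
  g \mPo [tuple match split i with
                | inl j => 'X_j
                | inr j => (e j)%:R
                end | i < m + t].

Definition VNP (K : nzRingType) (f : poly_family K) : Prop :=
  exists (t : nat -> nat) (g : forall n, {mpoly K[nvars f n + t n]}),
    [/\ p_bounded t,
        VP (PolyFamily g) &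
        forall n, f n = \sum_(e : {ffun 'I_(t n) -> bool}) subst_bits e (g n)].

Inductive gen_subalg (K : nzRingType) m (S : {mpoly K[m]} -> Prop) :
    {mpoly K[m]} -> Prop :=
  | gen_incl f of S f : gen_subalg S f
  | gen_const a : gen_subalg S a%:MP
  | gen_add f g of gen_subalg S f & gen_subalg S g : gen_subalg S (f + g)
  | gen_mul f g of gen_subalg S f & gen_subalg S g : gen_subalg S (f * g).

(* The first [m] inputs are the coordinates x, the other [r] the parameters y.
   [A] is the subalgebra to be generated; the equivalence includes that every
   specialisation of the circuit lies in [A]. *)
Definition succinctly_encodes (K : fieldType) m r
    (c : circuit rat ('I_m + 'I_r)) (A : {mpoly K[m]} -> Prop) : Prop :=
  let specialise (alpha : 'I_r -> K) : {mpoly K[m]} :=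
    circuit_eval (fun a => (ratr a)%:MP)
      (fun z => match z with inl i => 'X_i | inr j => (alpha j)%:MP end) c in
  forall f, gen_subalg (fun p => exists alpha, p = specialise alpha) f <-> A f.

(* The d-th tensor power of K^N, by coordinates in the basis
   e_(j 0) (x) ... (x) e_(j (d-1)) indexed by j : 'I_d -> 'I_N. *)
Notation multi_index d N := {ffun 'I_d -> 'I_N}.
Notation tensor K d N := {ffun multi_index d N -> K}.
Notation tensor_dim d N := #|{: multi_index d N}|.

Definition pure_tensor (K : comNzRingType) d N (v : 'I_d -> 'cV[K]_N) :
    tensor K d N :=
  [ffun i : multi_index d N => \prod_(l < d) v l (i l) 0].

Definition tensor_act (K : comNzRingType) d N (g : 'M[K]_N) (T : tensor K d N) :
    tensor K d N :=
  [ffun i : multi_index d N =>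
     \sum_(j : multi_index d N) (\prod_(l < d) g (i l) (j l)) * T j].

Lemma tensor_act_pure (K : comNzRingType) d N (g : 'M[K]_N)
    (v : 'I_d -> 'cV[K]_N) :
  tensor_act g (pure_tensor v) = pure_tensor (fun l => g *m v l).
Proof.
apply/ffunP=> i; rewrite !ffunE.
under [RHS]eq_bigr do rewrite mxE.
rewrite bigA_distr_bigA; apply: eq_bigr => j _.
by rewrite ffunE -big_split.
Qed.

Lemma tensor_act_linear (K : comNzRingType) d N (g : 'M[K]_N) :
  linear (@tensor_act K d N g : tensor K^o d N -> tensor K^o d N).
Proof.
move=> a S T; apply/ffunP=> i; rewrite !ffunE scaler_sumr -big_split /=.
by apply: eq_bigr => j _; rewrite !ffunE mulrDr /GRing.scale /= mulrCA.
Qed.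

Definition tensor_coord (K : Type) d N (T : tensor K d N) :
    'I_(tensor_dim d N) -> K :=
  fun i => T (enum_val i).

Definition SL_invariant (K : comNzRingType) d N
    (f : {mpoly K[tensor_dim d N]}) : Prop :=
  forall g : 'M[K]_N, \det g = 1 ->
  forall T : tensor K d N,
    f.@[tensor_coord (tensor_act g T)] = f.@[tensor_coord T].

(* Main.v *)
(** Write [N = 2kn]. On the tensors [T_X] supported on the basis vectors
    [e_(0,i) (x) ... (x) e_(k-1,i) (x) e_(k,j) (x) ... (x) e_(2k-1,j)] with
    coefficients [X i j], invariance under the diagonal torus and under block
    permutations (even, because [k] is even) forces every [SL_N]-invariant to have
    no terms of degree [1 .. n-1] and a multiple of [per X] in degree [n]. The
    hyperpfaffian is an invariant for which this multiple is not zero, hence so is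
    one of the generators, and the degree [n] component of its circuit is a small
    circuit for a nonzero multiple of the permanent.

    The permanent is complete for [VNP]. A permanent is the coefficient of a
    monomial in a product of affine forms. Conversely, homogenise a circuit so that
    each gate [g] has a positive weight; then it enters any computation of degree
    [D] at most [D] times, and substituting the value [phi] of the gate for its
    variable [u] in a polynomial [P] is extracting the coefficient of [u ^ M] from
    [P * sum_i u ^ (M - i) * phi ^ i], where the sum splits into factors
    [phi - z u] over the complex numbers. Summing over a bit is a similar
    extraction. When [phi] is a product of two variables, each factor is in turn a
    coefficient of a product of 14 affine forms in 7 new variables. *)

From HB Require Import structures.
Require Import Defs.
From mathcomp Require Import ring zify.
From mathcomp Require Import fingroup perm.
From mathcomp Require boolp.

Set Implicit Arguments.
Unset Strict Implicit.
Unset Printing Implicit Defensive.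

Import Order.TTheory GRing.Theory Num.Theory.
Local Open Scope ring_scope.

(** * Coefficients of products of affine forms *)

(** The obstacle to substituting gates by coefficient extraction is the exponent [M]: with repeated
    squaring a gate may be used exponentially often. A degree bound alone does not prevent this,
    since constants multiply for free. They are therefore stored as scalars of linear combinations
    and never as gates, and every remaining gate has positive weight. Gates are eliminated from the
    last to the first, and each substitution keeps the weighted degree at most [D].

    The passage from one invariant to one generator rests on the gap in degrees [1 .. n-1]: in a
    product of two restricted invariants, the terms of degree [n] come from a constant term times a
    term of degree [n]. Vanishing of the degree [n] part is thus inherited by everything that the
    generators generate. The generator found this way is not explicit; its complex parameters, and
    the inverse of its multiple of the permanent, become constants of the new circuit, where only
    gates are counted. *)

Section WeightedDegree.
Variables (V : finType) (B : comNzRingType).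
Notation A := {mpoly B[#|V|]}.
Implicit Types (lam a : V -> nat) (P Q : A) (v : V).

Definition pvar v : A := 'X_(enum_rank v).
Definition exp_mon a : 'X_{1..#|V|} := [multinom a (enum_val i) | i < #|V|].
Definition xcoef a Q : B := Q@_(exp_mon a).

Lemma xcoef_is_additive a : additive (xcoef a).
Proof. by move=> P Q; rewrite /xcoef mcoeffB. Qed.
HB.instance Definition _ a := GRing.isZmodMorphism.Build A B (xcoef a) (xcoef_is_additive a).

Lemma xcoefZ a c Q : xcoef a (c *: Q) = c * xcoef a Q.
Proof. exact: mcoeffZ. Qed.

Definition wdeg lam (m : 'X_{1..#|V|}) : nat := (\sum_v lam v * m (enum_rank v))%N.

Lemma wdeg0 lam : wdeg lam 0%MM = 0%N.
Proof. by rewrite /wdeg big1 // => v _; rewrite mnm0E muln0. Qed.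

Lemma wdegD lam m1 m2 : wdeg lam (m1 + m2)%MM = (wdeg lam m1 + wdeg lam m2)%N.
Proof. by rewrite /wdeg -big_split /=; apply: eq_bigr => v _; rewrite mnmDE mulnDr. Qed.

Lemma wdeg1 lam v : wdeg lam U_(enum_rank v)%MM = lam v.
Proof.
rewrite /wdeg (bigD1 v) //= big1 => [|w /negbTE wv].
  by rewrite mnm1E eqxx muln1 addn0.
by rewrite mnm1E (inj_eq enum_rank_inj) eq_sym wv muln0.
Qed.

Lemma wdeg_exp_mon lam a : wdeg lam (exp_mon a) = (\sum_v lam v * a v)%N.
Proof. by apply: eq_bigr => v _; rewrite mnmE enum_rankK. Qed.

(** One relation serves two purposes: with positive weights it bounds a degree, and with 0/1 weights
    and [d = 0] it says that the variables of weight 1 do not occur. *)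
Definition wle lam d Q := forall m, m \in msupp Q -> (wdeg lam m <= d)%N.

Lemma wle_leq lam d1 d2 Q : (d1 <= d2)%N -> wle lam d1 Q -> wle lam d2 Q.
Proof. by move=> le12 h m /h /leq_trans; apply. Qed.

Lemma wle_leqw lam1 lam2 d Q :
  (forall v, (lam1 v <= lam2 v)%N) -> wle lam2 d Q -> wle lam1 d Q.
Proof.
move=> le12 h m /h; apply: leq_trans.
by apply: leq_sum => v _; rewrite leq_mul2r le12 orbT.
Qed.

Lemma wleC lam c : wle lam 0 (c%:MP : A).
Proof. by move=> m; rewrite msuppC; case: eqP => // _; rewrite inE => /eqP->; rewrite wdeg0. Qed.

Lemma wle1 lam : wle lam 0 (1 : A).
Proof. by rewrite -mpolyC1; apply: wleC. Qed.

Lemma wle0 lam d : wle lam d (0 : A).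
Proof. by move=> m; rewrite msupp0. Qed.

Lemma wle_var lam v : wle lam (lam v) (pvar v).
Proof. by move=> m; rewrite msuppX inE => /eqP->; rewrite wdeg1. Qed.

Lemma wleD lam d P Q : wle lam d P -> wle lam d Q -> wle lam d (P + Q).
Proof.
by move=> hP hQ m /msuppD_le; rewrite mem_cat => /orP[/hP|/hQ].
Qed.

Lemma wleM lam d1 d2 P Q : wle lam d1 P -> wle lam d2 Q -> wle lam (d1 + d2) (P * Q).
Proof.
move=> hP hQ m /msuppM_le /allpairsP[[m1 m2] /= [/hP h1 /hQ h2 ->]].
by rewrite wdegD leq_add.
Qed.

Lemma wleZ lam d c P : wle lam d P -> wle lam d (c *: P).
Proof. by move=> hP m /msuppZ_le /hP. Qed.

Lemma wleN lam d P : wle lam d P -> wle lam d (- P).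
Proof. by rewrite -scaleN1r; apply: wleZ. Qed.

Lemma wleB lam d P Q : wle lam d P -> wle lam d Q -> wle lam d (P - Q).
Proof. by move=> hP hQ; apply: wleD => //; apply: wleN. Qed.

Lemma wle_sum lam d I (r : seq I) (C : pred I) (F : I -> A) :
  (forall i, C i -> wle lam d (F i)) -> wle lam d (\sum_(i <- r | C i) F i).
Proof. by move=> h; elim/big_rec: _ => [|i x Ci IH]; [apply: wle0|apply: wleD => //; apply: h]. Qed.

Lemma wle_exp lam d P n : wle lam d P -> wle lam (n * d) (P ^+ n).
Proof.
move=> h; elim: n => [|n IH]; first by rewrite expr0; apply: wle1.
by rewrite exprS mulSn; apply: wleM.
Qed.

Lemma xcoef_wle0 lam d a Q :
  wle lam d Q -> (d < \sum_v lam v * a v)%N -> xcoef a Q = 0.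
Proof.
move=> h lt; apply/eqP; rewrite mcoeff_eq0; apply/negP => /h.
by rewrite wdeg_exp_mon leqNgt lt.
Qed.

Definition unit_weight v : V -> nat := fun w => (w == v).
Definition vfree v Q := wle (unit_weight v) 0 Q.

Lemma sum_unit_weight v a : (\sum_w unit_weight v w * a w)%N = a v.
Proof.
rewrite (bigD1 v) //= /unit_weight eqxx mul1n big1 ?addn0 // => w /negbTE->.
by rewrite mul0n.
Qed.

Lemma vfree_var v w : v != w -> vfree v (pvar w).
Proof. by move=> vw; have := @wle_var (unit_weight v) w; rewrite /unit_weight eq_sym (negbTE vw). Qed.

Lemma vfreeD v P Q : vfree v P -> vfree v Q -> vfree v (P + Q).
Proof. exact: wleD. Qed.
Lemma vfreeB v P Q : vfree v P -> vfree v Q -> vfree v (P - Q).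
Proof. exact: wleB. Qed.
Lemma vfreeM v P Q : vfree v P -> vfree v Q -> vfree v (P * Q).
Proof. exact: wleM. Qed.
Lemma vfreeZ v c P : vfree v P -> vfree v (c *: P).
Proof. exact: wleZ. Qed.
Lemma vfreeC v c : vfree v (c%:MP).
Proof. exact: wleC. Qed.
Lemma vfree1 v : vfree v 1.
Proof. exact: wle1. Qed.
Lemma vfree_nat v n : vfree v n%:R.
Proof. by rewrite -mpolyC_nat; apply: vfreeC. Qed.
Lemma vfree_exp v P n : vfree v P -> vfree v (P ^+ n).
Proof. by move=> h; rewrite /vfree -[0%N](muln0 n); apply: wle_exp. Qed.
Lemma vfree_prod v I (r : seq I) (C : pred I) (F : I -> A) :
  (forall i, C i -> vfree v (F i)) -> vfree v (\prod_(i <- r | C i) F i).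
Proof.
by move=> h; elim/big_rec: _ => [|i x Ci IH]; [apply: vfree1|apply: vfreeM => //; apply: h].
Qed.
Lemma vfree_sum v I (r : seq I) (C : pred I) (F : I -> A) :
  (forall i, C i -> vfree v (F i)) -> vfree v (\sum_(i <- r | C i) F i).
Proof. exact: wle_sum. Qed.

(** Together with [xcoef_high] this leaves only the power [n = a v]: a smaller one cannot reach the
    exponent, as [Q] has no [v] to add, and a larger one overshoots it. *)
Lemma xcoef_free v n a Q : vfree v Q -> (n < a v)%N -> xcoef a (pvar v ^+ n * Q) = 0.
Proof.
move=> hQ lt; apply: (@xcoef_wle0 (unit_weight v) n); last by rewrite sum_unit_weight.
rewrite -[n in wle _ n]addn0; apply: wleM => //.
by have := @wle_exp (unit_weight v) _ _ n (@wle_var (unit_weight v) v); rewrite /unit_weight eqxx muln1.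
Qed.

Lemma xcoef_high v n a Q : (a v < n)%N -> xcoef a (pvar v ^+ n * Q) = 0.
Proof.
move=> lt; apply/eqP; rewrite mcoeff_eq0; apply/negP => /msuppM_le.
case/allpairsP => -[m1 m2] /= [h1 _] E.
have := mnmE (fun i => a (enum_val i)) (enum_rank v); rewrite -/(exp_mon a) enum_rankK E mnmDE.
move: h1; rewrite /pvar mpolyXn msuppX inE => /eqP->; rewrite mulmnE mnm1E eqxx mul1n.
by move=> avE; move: lt; rewrite -avE ltnNge leq_addr.
Qed.

End WeightedDegree.

Section Homogenize.
Variables (K : fieldType) (S : comNzRingType) (iota : {rmorphism K -> S}).

(** Homogeneous form of a split monic polynomial. The induction multiplies by [x - iota z * y] and
    never divides by [y], so the identity holds in polynomial rings. *)
Lemma homogenize_roots (r : seq K) (x y : S) :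
  \sum_(i < (size r).+1) iota (\prod_(z <- r) ('X - z%:P))`_i * (x ^+ i * y ^+ (size r - i))
  = \prod_(z <- r) (x - iota z * y).
Proof.
elim: r => [|z r IH] /=.
  by rewrite big_ord1 !big_nil coef1 /= rmorph1 subnn !expr0 !mulr1.
rewrite [RHS]big_cons -IH mulrBl.
set p := \prod_(z <- r) _.
(* [p] has degree [size r]; the vanishing of the next coefficient drops the surplus last term of the
   second shifted sum. *)
have sp : p`_(size r).+1 = 0 by apply: nth_default; rewrite size_prod_XsubC.
under eq_bigr => i _ do rewrite big_cons mulrBl coefB coefXM coefCM -/p rmorphB mulrBl.
rewrite sumrB; congr (_ - _).
  rewrite big_ord_recl /= rmorph0 mul0r add0r mulr_sumr; apply: eq_bigr => i _.
  by rewrite /bump /= add0n add1n subSS exprS; ring.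
rewrite big_ord_recr /= sp mulr0 rmorph0 mul0r addr0 mulr_sumr; apply: eq_bigr => i _.
rewrite subSn; last by rewrite -ltnS.
by rewrite rmorphM exprS /=; ring.
Qed.
End Homogenize.

Ltac vfree_step :=
  lazymatch goal with
  | |- vfree _ (_ * _) => apply: vfreeM
  | |- vfree _ (_ - _) => apply: vfreeB
  | |- vfree _ (_ + _) => apply: vfreeD
  | |- vfree _ 1 => apply: vfree1
  | |- vfree _ (pvar _ _) => apply: vfree_var
  end.

(** * Affine factors that simulate a product of two variables *)

Section Gadgets.
Variables (V : finType) (B : comNzRingType) (a : V -> nat).
Notation A := {mpoly B[#|V|]}.
Implicit Types (x y z Q : A) (w : V).

Definition triple_gadget w1 w2 w3 x y z : seq A :=
  let W1 := pvar B w1 in let W2 := pvar B w2 in let W3 := pvar B w3 in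
  [:: W1 + x; W2 + y; W3 + z;
      1 + W1 + W2 + W3; 1 + W1 - W2 - W3; 1 - W1 + W2 - W3; 1 - W1 - W2 + W3].

(* Modulo the squares of the [W_i] the last four factors multiply to
   [1 + 8 W1 W2 W3]: their linear and quadratic parts cancel. *)
Lemma xcoef_triple_gadget w1 w2 w3 x y z Q :
  uniq [:: w1; w2; w3] -> {in [:: w1; w2; w3], forall w,
    [/\ a w = 1%N, vfree w x, vfree w y, vfree w z & vfree w Q]} ->
  xcoef a ((\prod_(l <- triple_gadget w1 w2 w3 x y z) l) * Q) =
  xcoef a ((1 + 8%:R * x * y * z) * (pvar B w1 * pvar B w2 * pvar B w3) * Q).
Proof.
rewrite /= !inE negb_or !andbT => /andP[/andP[n12 n13] n23] H.
have [a1 x1 y1 z1 Q1] := H w1 (mem_head _ _).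
have [|a2 x2 y2 z2 Q2] := H w2; first by rewrite !inE eqxx orbT.
have [|a3 x3 y3 z3 Q3] := H w3; first by rewrite !inE eqxx !orbT.
rewrite /triple_gadget !big_cons big_nil mulr1.
set W1 := pvar B w1; set W2 := pvar B w2; set W3 := pvar B w3.
set G := (X in xcoef a (X * Q) = _).
(* The last four factors multiply exactly to [1 + 8 W1 W2 W3 + W1^2 T1 + W2^2 T2 + W3^2 T3]. *)
pose T1 := -2%:R + W1 ^+ 2 - 2%:R * W2 ^+ 2 - 2%:R * W3 ^+ 2.
pose T2 := -2%:R + W2 ^+ 2 - 2%:R * W3 ^+ 2.
pose T3 := -2%:R + W3 ^+ 2.
pose C := (W1 + x) * (W2 + y) * (W3 + z).
(* Apart from the first, terms are sorted by the reason why they drop out: after [^+ 0] the cofactor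
   lacks that variable, and [^+ 2] exceeds its exponent, which is 1. *)
have -> : G * Q = (1 + 8%:R * x * y * z) * (W1 * W2 * W3) * Q
   + W1 ^+ 0 * (x * (W2 + y) * (W3 + z) * Q)
   + W2 ^+ 0 * (W1 * y * (W3 + z) * Q) + W3 ^+ 0 * (W1 * W2 * z * Q)
   + W1 ^+ 2 * ((8%:R * W2 * W3 * (W2 + y) * (W3 + z) + C * T1) * Q)
   + W2 ^+ 2 * ((8%:R * W1 * W3 * x * (W3 + z) + C * T2) * Q)
   + W3 ^+ 2 * ((8%:R * W1 * W2 * x * y + C * T3) * Q).
  by rewrite /G /C /T1 /T2 /T3; ring.
have [n21 n31 n32] : [/\ w2 != w1, w3 != w1 & w3 != w2] by split; rewrite eq_sym.
rewrite !raddfD /= (@xcoef_free _ _ w1) ?a1 //; last first.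
  by rewrite /W1 /W2 /W3; repeat vfree_step.
rewrite (@xcoef_free _ _ w2) ?a2 //; last first.
  by rewrite /W1 /W2 /W3; repeat vfree_step.
rewrite (@xcoef_free _ _ w3) ?a3 //; last first.
  by rewrite /W1 /W2 /W3; repeat vfree_step.
by rewrite !xcoef_high ?a1 ?a2 ?a3 // !addr0.
Qed.

Lemma vfree_triple_gadget w w1 w2 w3 x y z :
  w != w1 -> w != w2 -> w != w3 -> vfree w x -> vfree w y -> vfree w z ->
  vfree w (\prod_(l <- triple_gadget w1 w2 w3 x y z) l).
Proof.
move=> n1 n2 n3 fx fy fz; rewrite /triple_gadget !big_cons big_nil.
by repeat vfree_step.
Qed.

(* The product [ua * ub - z * u] is the coefficient of [v] in
   [(1 - z v u) * (1 + v ua ub)]; each factor is a triple gadget, [h] being [1/8]. *)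
Definition slot_rows (z h : B) (p : 'I_7 -> V) (u ua ub : V) : seq A :=
  let v := pvar B (p (inord 0)) in
  triple_gadget (p (inord 1)) (p (inord 2)) (p (inord 3))
    v (pvar B u) (- (h * z))%:MP ++
  triple_gadget (p (inord 4)) (p (inord 5)) (p (inord 6))
    (h *: v) (pvar B ua) (pvar B ub).

Lemma xcoef_slot_rows (z h : B) p (u ua ub : V) Q :
  8%:R * h = 1 ->
  injective p -> (forall i, a (p i) = 1%N) -> (forall i, vfree (p i) Q) ->
  (forall i, [/\ p i != u, p i != ua & p i != ub]) ->
  xcoef a ((\prod_(l <- slot_rows z h p u ua ub) l) * Q) =
  xcoef a ((pvar B ua * pvar B ub - z *: pvar B u) * (\prod_i pvar B (p i)) * Q).
Proof.
move=> h8 pI ap pQ pu.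
have neq (i j : nat) : (i < 7)%N -> (j < 7)%N -> (i != j) -> p (inord i) != p (inord j).
  by move=> i7 j7; apply: contraNneq => /pI /(congr1 val); rewrite /= !inordK // => ->.
have pf i j : (i < 7)%N -> (j < 7)%N -> (i != j) -> vfree (p (inord i)) (pvar B (p (inord j))).
  by move=> i7 j7 ij; apply: vfree_var; apply: neq.
have pfu i w : w \in [:: u; ua; ub] -> vfree (p i) (pvar B w).
  by move=> wi; apply: vfree_var; have [h1 h2 h3] := pu i;
     move: wi; rewrite !inE => /or3P[]/eqP->.
rewrite /slot_rows big_cat /=.
set g1 := (\prod_(l <- _) l); set g2 := (\prod_(l <- _) l).
have -> : \prod_i pvar B (p i) = pvar B (p (inord 0)) *
    ((pvar B (p (inord 1)) * pvar B (p (inord 2)) * pvar B (p (inord 3))) *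
     (pvar B (p (inord 4)) * pvar B (p (inord 5)) * pvar B (p (inord 6)))).
  have -> : \prod_i pvar B (p i) = \prod_(0 <= i < 7) pvar B (p (inord i)).
    by rewrite big_mkord; apply: eq_bigr => i _; rewrite inord_val.
  by do 7 (rewrite big_ltn //); rewrite big_geq //; ring.
set v := pvar B (p (inord 0)).
set W := (X in v * (X * _)); set W' := (X in v * (W * X)).
rewrite -mulrA /g1 xcoef_triple_gadget; last first.
- have fg2 i : (0 < i < 4)%N -> vfree (p (inord i)) g2.
    case/andP=> i0 i4; apply: vfree_triple_gadget; try (apply: neq; lia).
    + by apply: vfreeZ; apply: pf; lia.
    + by apply: pfu; rewrite !inE eqxx ?orbT.
    + by apply: pfu; rewrite !inE eqxx ?orbT.
  have fu i : vfree (p i) (pvar B u) by apply: pfu; rewrite !inE eqxx.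
  by move=> w; rewrite !inE => /or3P[]/eqP->;
    (split; [exact: ap|exact: pf|exact: fu|exact: vfreeC|apply: vfreeM; [exact: fg2|exact: pQ]]).
- by rewrite /= !inE !negb_or !neq.
rewrite -/W -/v; set U := pvar B u; set c1 := 1 + _.
have -> : c1 * W * (g2 * Q) = g2 * (c1 * W * Q) by ring.
have fc1 i : (3 < i < 7)%N -> vfree (p (inord i)) (c1 * W * Q).
  case/andP=> i3 i7; apply: vfreeM => //.
  apply: vfreeM; last by repeat (apply: vfreeM || apply: pf); lia.
  apply: vfreeD; first exact: vfree1.
  repeat apply: vfreeM; [exact: vfree_nat|apply: pf; lia| |exact: vfreeC].
  by apply: pfu; rewrite !inE eqxx.
rewrite /g2 xcoef_triple_gadget; last first.
- by move=> w; rewrite !inE => /or3P[]/eqP->;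
    (split; [exact: ap|by apply: vfreeZ; apply: pf|apply: pfu|apply: pfu|exact: fc1]);
    rewrite !inE eqxx ?orbT.
- by rewrite /= !inE !negb_or !neq.
rewrite -/W' /c1 -/v; set Ua := pvar B ua; set Ub := pvar B ub.
pose H := (h%:MP : A); pose Z := (z%:MP : A).
have H8 : 8%:R * H = 1 by rewrite /H -mpolyC_nat -mpolyCM h8 mpolyC1.
have -> : (- (h * z))%:MP = - (H * Z) :> A by rewrite mpolyCN mpolyCM.
rewrite -!mul_mpolyC -/H -/Z.
(* Sorted by powers of [v], whose exponent is 1: only the linear part survives. *)
have -> : (1 + 8%:R * (H * v) * Ua * Ub) * W' *
    ((1 + 8%:R * v * U * - (H * Z)) * W * Q) =
  (Ua * Ub - Z * U) * (v * (W * W')) * Q + v ^+ 0 * (W * W' * Q) +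
  v ^+ 2 * (- (Z * U * Ua * Ub) * (W * W') * Q).
  have -> : 8%:R * v * U * - (H * Z) = - ((8%:R * H) * (v * U * Z)) by ring.
  have -> : 8%:R * (H * v) * Ua * Ub = (8%:R * H) * (v * Ua * Ub) by ring.
  by rewrite H8; ring.
rewrite !raddfD /= (@xcoef_high _ _ _ 2) ?ap // (@xcoef_free _ _ _ 0) ?ap ?addr0 //.
by repeat (apply: vfreeM || apply: pf).
Qed.
End Gadgets.

Section Rearrange.
Variable S : comNzRingType.
Implicit Types x v w f r : S.
Lemma rearrange1 x v w r1 r2 r3 r4 :
  x * v * (w * r1 * r2 * r3 * r4) = v * w * (x * r1 * r2 * r3 * r4).
Proof. by ring. Qed.
Lemma rearrange2 x v r1 r2 r3 r4 :
  v * (x * r1 * r2 * r3 * r4) = x * (r1 * (v * r2) * r3 * r4).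
Proof. by ring. Qed.
Lemma rearrange3 x v w r1 r2 r3 r4 :
  x * v * (r1 * (w * r2) * r3 * r4) = v * w * (x * r1 * r2 * r3 * r4).
Proof. by ring. Qed.
Lemma rearrange4 x v f r1 r2 r3 r4 :
  f * v * (x * r1 * r2 * r3 * r4) = (x * f) * (r1 * r2 * (v * r3) * r4).
Proof. by ring. Qed.
Lemma rearrange5 x c (i j : nat) r :
  x ^+ i * (c * x ^+ j) * r = x ^+ (i + j) * (c * r).
Proof. by rewrite exprD; ring. Qed.
End Rearrange.

Section PowElim.
Variables (V : finType) (B : comNzRingType) (a : V -> nat).
Notation A := {mpoly B[#|V|]}.

(** A linear map on powers of [v] realised by a multiplication: extraction at [v ^ M] pairs [v ^ i]
    with the summand [m = i] only. With [c m = phi ^ m] it is a substitution, with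
    [c m = bit_moment m] the sum over a bit. *)
Lemma xcoef_pow_elim (v : V) M (c : nat -> A) i (Q : A) :
  a v = M -> (i <= M)%N -> (forall m, vfree v (c m)) -> vfree v Q ->
  xcoef a (pvar B v ^+ i * (\sum_(m < M.+1) c m * pvar B v ^+ (M - m)) * Q) =
  xcoef a (c i * pvar B v ^+ M * Q).
Proof.
move=> aM iM fc fQ; rewrite mulr_sumr mulr_suml raddf_sum /=.
rewrite (bigD1 (Ordinal (iM : (i < M.+1)%N))) //= big1 ?addr0.
  have -> : pvar B v ^+ i * (c i * pvar B v ^+ (M - i)) = c i * pvar B v ^+ M.
    by rewrite mulrCA -exprD subnKC.
  by [].
move=> m; rewrite -val_eqE /= => mi.
have -> : pvar B v ^+ i * (c m * pvar B v ^+ (M - m)) * Q =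
          pvar B v ^+ (i + (M - m)) * (c m * Q) by exact: rearrange5.
have mM : (m <= M)%N by rewrite -ltnS.
have [lt|ge] := ltnP m i; first by apply: xcoef_high; rewrite aM; lia.
by apply: xcoef_free; [apply: vfreeM|rewrite aM; lia].
Qed.

Definition mnm_drop (v : V) (m : 'X_{1..#|V|}) : 'X_{1..#|V|} :=
  [multinom if i == enum_rank v then 0%N else m i | i < #|V|].

Lemma mnm_dropE v (m : 'X_{1..#|V|}) w :
  mnm_drop v m (enum_rank w) = if w == v then 0%N else m (enum_rank w).
Proof. by rewrite mnmE (inj_eq enum_rank_inj). Qed.

Lemma mnm_dropK v (m : 'X_{1..#|V|}) :
  m = (mnm_drop v m + U_(enum_rank v) *+ m (enum_rank v))%MM.
Proof.
apply/mnmP => i; rewrite mnmDE mulmnE mnm1E mnmE eq_sym.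
by case: eqP => [->|_]; rewrite ?mul1n ?mul0n ?addn0 ?add0n.
Qed.

Lemma mpolyX_mnm_drop v (m : 'X_{1..#|V|}) :
  'X_[m] = 'X_[mnm_drop v m] * pvar B v ^+ m (enum_rank v) :> A.
Proof. by rewrite {1}(mnm_dropK v m) mpolyXD mpolyXn. Qed.

Lemma wdeg_mnm_drop lam v m :
  wdeg lam m = (wdeg lam (mnm_drop v m) + lam v * m (enum_rank v))%N.
Proof.
rewrite /wdeg (bigD1 v) //= [in RHS](bigD1 v) //= mnm_dropE eqxx muln0 add0n addnC.
by congr addn; apply: eq_bigr => w /negbTE wv; rewrite mnm_dropE wv.
Qed.

Lemma wle_mon lam d (m : 'X_{1..#|V|}) : (wdeg lam m <= d)%N -> wle lam d ('X_[m] : A).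
Proof. by move=> le m'; rewrite msuppX inE => /eqP->. Qed.

Lemma vfree_mnm_drop v m : vfree v ('X_[mnm_drop v m] : A).
Proof.
apply: wle_mon; rewrite /wdeg big1 // => w _.
by rewrite mnm_dropE /unit_weight; case: eqP; rewrite ?muln0 ?mul0n.
Qed.

Lemma vfree_wle lam v (Q : A) : (0 < lam v)%N -> wle lam 0 Q -> vfree v Q.
Proof. by move=> lv; apply: wle_leqw => w; rewrite /unit_weight; case: eqP => // ->. Qed.

Lemma mpolyX_exp_mon : 'X_[exp_mon a] = \prod_v pvar B v ^+ a v :> A.
Proof.
rewrite mpolyXE_id (reindex enum_rank) /=; last first.
  by exists enum_val => i _; rewrite ?enum_rankK ?enum_valK.
by apply: eq_bigr => v _; rewrite mnmE enum_rankK.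
Qed.

Lemma xcoef_exp_mon : xcoef a ('X_[exp_mon a] : A) = 1.
Proof. by rewrite /xcoef mcoeffX eqxx. Qed.

End PowElim.

(** * Substituting gates and summing over bits by extraction *)

Section Elimination.
Variables (B : comNzRingType) (t s M : nat) (F : finType).
Notation V := ('I_t + 'I_s + F)%type.
Notation A := {mpoly B[#|{: V}|]}.
Variables (phi : 'I_s -> A) (w : 'I_s -> nat).
Variables (val : {ffun 'I_t -> bool} -> 'I_s -> B).

Definition bvar j : A := pvar B (inl (inl j) : V).
Definition gvar g : A := pvar B (inl (inr g) : V).
Definition fvar f : A := pvar B (inr f : V).
Definition gexp (v : V) : nat := if v is inl _ then M else 1%N.
Definition gwt (v : V) : nat :=
  match v with inl (inl _) => 1%N | inl (inr g) => w g | inr _ => 0%N end.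
(** [wle (gate_from k) 0 P] says that [P] involves only bits and gates of index below [k]; for
    [phi g] and [k = g] this is acyclicity of the computation. *)
Definition gate_from k (v : V) : nat :=
  match v with inl (inl _) => 0%N | inl (inr g) => (k <= g)%N | inr _ => 1%N end.
Definition genv (e : {ffun 'I_t -> bool}) (v : V) : B :=
  match v with inl (inl j) => (e j)%:R | inl (inr g) => val e g | inr _ => 0 end.

(* [bit_moment i = 0 ^ i + 1 ^ i]. *)
Definition bit_moment (i : nat) : nat := if i is 0 then 2 else 1.
Definition bit_factor j : A := \sum_(i < M.+1) (bit_moment i)%:R * bvar j ^+ (M - i).
(* Extracting the coefficient of [u_g ^ M] from [P * gate_factor g] substitutes
   [phi g] for [u_g] in [P], as long as [P] has degree at most [M] in [u_g];
   [bit_factor] likewise sums over the two values of a bit. *)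
Definition gate_factor g : A := \sum_(i < M.+1) phi g ^+ i * gvar g ^+ (M - i).

Hypothesis w_gt0 : forall g, (0 < w g)%N.
Hypothesis phi_wt : forall g, wle gwt (w g) (phi g).
Hypothesis phi_from : forall g : 'I_s, wle (gate_from g) 0 (phi g).
Hypothesis phi_val : forall e g, (phi g).@[fun i => genv e (enum_val i)] = val e g.

Notation gcoef := (xcoef gexp).

Lemma prod_gexp : 'X_[exp_mon gexp] =
  (\prod_j bvar j ^+ M) * (\prod_g gvar g ^+ M) * (\prod_f fvar f) :> A.
Proof.
rewrite mpolyX_exp_mon big_sumType /= big_sumType /=; by [].
Qed.

(** Bits are summed out from the last to the first. A bit already treated leaves the bare power
    [bvar j ^+ M], which keeps the extracted exponent right, and its moment comes out as a
    scalar. *)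
Lemma xcoef_bits (m : 'X_{1..#|{: V}|}) (k : nat) :
  (k <= t)%N -> (forall v : V, m (enum_rank v) <= M)%N ->
  (forall v : V, (if v is inl (inl j) then (k <= j)%N else true) -> m (enum_rank v) = 0%N) ->
  gcoef ('X_[m] * ((\prod_(j : 'I_t | (j < k)%N) bit_factor j) * (\prod_(j : 'I_t | (k <= j)%N) bvar j ^+ M)
      * (\prod_g gvar g ^+ M) * (\prod_f fvar f))) =
  \prod_(j : 'I_t | (j < k)%N) (bit_moment (m (enum_rank (inl (inl j) : V))))%:R.
Proof.
elim: k m => [|k IH] m kt mM m0.
  have -> : m = 0%MM.
    by apply/mnmP => i; rewrite -(enum_valK i) mnm0E m0 //; case: (enum_val i) => // -[].
  rewrite mpolyX0 mul1r [\prod_(j : 'I_t | (_ < 0)%N) bit_factor j]big_pred0 // [RHS]big_pred0 // mul1r.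
  rewrite -[RHS](xcoef_exp_mon B (gexp : V -> nat)); congr xcoef.
  by rewrite prod_gexp.
pose kk := Ordinal kt; pose v : V := inl (inl kk).
have e1 (j : 'I_t) : (j < k.+1)%N && (j != kk) = (j < k)%N.
  by rewrite -val_eqE /= ltnS ltn_neqAle andbC.
have e2 (j : 'I_t) : (k <= j)%N && (j != kk) = (k < j)%N.
  by rewrite -val_eqE /= ltn_neqAle andbC eq_sym.
rewrite (bigD1 kk) //= (eq_bigl _ _ e1) [RHS](bigD1 kk) //= [in RHS](eq_bigl _ _ e1).
rewrite (mpolyX_mnm_drop B v) -/v.
set i := m (enum_rank v); set R1 := \prod_(j : 'I_t | (j < k)%N) bit_factor j.
set R2 := \prod_(j : 'I_t | (k < j)%N) _; set R3 := \prod_g _; set R4 := \prod_f _.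
have -> : 'X_[mnm_drop v m] * pvar B v ^+ i * (bit_factor kk * R1 * R2 * R3 * R4) =
   pvar B v ^+ i * bit_factor kk * ('X_[mnm_drop v m] * R1 * R2 * R3 * R4) by exact: rearrange1.
rewrite /bit_factor (xcoef_pow_elim (c := fun i => (bit_moment i)%:R)) //.
- rewrite -[(bit_moment i)%:R in LHS]mpolyC_nat mul_mpolyC -scalerAl xcoefZ; congr (_ * _).
  have -> : pvar B v ^+ M * ('X_[mnm_drop v m] * R1 * R2 * R3 * R4) =
     'X_[mnm_drop v m] * (R1 * (pvar B v ^+ M * R2) * R3 * R4) by exact: rearrange2.
  have -> : pvar B v ^+ M * R2 = \prod_(j : 'I_t | (k <= j)%N) bvar j ^+ M.
    by rewrite [RHS](bigD1 kk) //=; congr (_ * _); apply: eq_bigl => j; rewrite e2.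
  rewrite IH.
  + apply: eq_bigr => j jk; rewrite mnm_dropE; case: eqP => // -[jj].
    by move: jk; rewrite jj /= ltnn.
  + exact: ltnW.
  + by move=> u; rewrite mnm_dropE; case: eqP.
  + move=> u hu; rewrite mnm_dropE; case: eqP => // /eqP uv; apply: m0.
    case: u hu uv => // -[] // j kj uv; rewrite ltn_neqAle kj andbT.
    by apply: contraNneq uv => kj'; apply/eqP; congr (inl (inl _)); apply: val_inj.
- exact: mM.
- by move=> j; apply: vfree_nat.
- rewrite /R1 /R2 /R3 /R4.
  repeat (apply: vfreeM); first exact: vfree_mnm_drop.
  + apply: vfree_prod => j jk; apply: vfree_sum => l _; apply: vfreeM; first exact: vfree_nat.
    apply: vfree_exp; apply: vfree_var; apply/eqP => -[jj].
    by move: jk; rewrite -jj /= ltnn.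
  + apply: vfree_prod => j jk; apply: vfree_exp; apply: vfree_var; apply/eqP => -[jj].
    by move: jk; rewrite -jj /= ltnn.
  + by apply: vfree_prod => j jk; apply: vfree_exp; apply: vfree_var.
  + by apply: vfree_prod => j jk; apply: vfree_var.
Qed.

(** The gate of highest index is substituted first: its [phi] involves only older gates, so the
    induction continues with a polynomial in fewer gates. As [phi g] has weight at most [w g], the
    bound [D] is preserved and no exponent exceeds [M]. *)
Lemma xcoef_gates (P : A) (D k : nat) :
  (D <= M)%N -> (k <= s)%N -> wle gwt D P -> wle (gate_from k) 0 P ->
  gcoef (P * ((\prod_j bit_factor j) * (\prod_(g : 'I_s | (g < k)%N) gate_factor g) *
      (\prod_(g : 'I_s | (k <= g)%N) gvar g ^+ M) * (\prod_f fvar f))) =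
  \sum_e P.@[fun i => genv e (enum_val i)].
Proof.
move=> DM; elim: k P => [|k IH] P ks wP fP.
- rewrite {1}(mpolyE P) mulr_suml raddf_sum /=.
  under [RHS]eq_bigr => e _ do rewrite mevalE.
  rewrite exchange_big /= big_seq [RHS]big_seq; apply: eq_bigr => m mP.
  rewrite -scalerAl xcoefZ -mulr_sumr; congr (_ * _).
  have m0 (v : V) : (if v is inl (inl _) then false else true) -> m (enum_rank v) = 0%N.
    move=> hv; have := fP m mP; rewrite leqn0 /wdeg sum_nat_eq0 => /forallP/(_ v)/=.
    by case: v hv => [[j|g]|f] //= _; rewrite mul1n => /eqP.
  have mM (v : V) : (m (enum_rank v) <= M)%N.
    have := wP m mP; rewrite (wdeg_mnm_drop _ v) => hD.
    case E : v => [[j|g]|f]; rewrite -E; last by rewrite m0 // E.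
      by move: hD; rewrite E /= mul1n => /(leq_trans (leq_addl _ _))/leq_trans; apply.
    by rewrite m0 // E.
  rewrite [\prod_(g : 'I_s | (_ < 0)%N) _]big_pred0 // mulr1.
  have := @xcoef_bits m t (leqnn t) mM.
  rewrite [\prod_(j : 'I_t | (j < t)%N) bit_factor j](eq_bigl xpredT); last by move=> j; rewrite ltn_ord.
  rewrite [\prod_(j : 'I_t | (t <= j)%N) _]big_pred0; last by move=> j; rewrite leqNgt ltn_ord.
  rewrite mulr1 => ->; last first.
    by move=> v hv; apply: m0; case: v hv => // -[] // j; rewrite leqNgt ltn_ord.
  rewrite [\prod_(j : 'I_t | (j < t)%N) _](eq_bigl xpredT); last by move=> j; rewrite ltn_ord.
  (* Each moment is a sum over the two values of a bit, with [0 ^+ 0 = 1]; distributing the product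
     gives one term for each assignment [e]. *)
  pose G (j : 'I_t) (b : bool) : B := b%:R ^+ m (enum_rank (inl (inl j) : V)).
  have -> : \prod_j (bit_moment (m (enum_rank (inl (inl j) : V))))%:R = \prod_j \sum_(b : bool) G j b.
    apply: eq_bigr => j _; rewrite big_bool /G /= expr1n.
    by case: (m _) => [|i]; rewrite /bit_moment /= ?expr0 ?expr0n /= ?addr0.
  rewrite bigA_distr_bigA /=; apply: eq_bigr => e _.
  rewrite [RHS](reindex enum_rank) /=; last first.
    by exists enum_val => i _; rewrite ?enum_rankK ?enum_valK.
  rewrite big_sumType big_sumType /= [X in _ * X * _]big1; last first.
    by move=> g _; rewrite m0 // expr0.
  rewrite [X in _ * X]big1 ?mulr1; last by move=> f _; rewrite m0 // expr0.
  by apply: eq_bigr => j _; rewrite enum_rankK.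
- pose kk := Ordinal ks; pose v : V := inl (inr kk).
  have e1 (j : 'I_s) : (j < k.+1)%N && (j != kk) = (j < k)%N.
    by rewrite -val_eqE /= ltnS ltn_neqAle andbC.
  have e2 (j : 'I_s) : (k <= j)%N && (j != kk) = (k < j)%N.
    by rewrite -val_eqE /= ltn_neqAle andbC eq_sym.
  rewrite {1}(mpolyE P) mulr_suml raddf_sum /=.
  under [RHS]eq_bigr => e _ do rewrite mevalE.
  rewrite exchange_big /= big_seq [RHS]big_seq; apply: eq_bigr => m mP.
  rewrite -scalerAl xcoefZ -mulr_sumr; congr (_ * _).
  under [RHS]eq_bigr => e _ do rewrite -mevalX.
  rewrite (bigD1 kk) //= (eq_bigl _ _ e1).
  have wm := wP m mP; have fm := fP m mP.
  set i := m (enum_rank v).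
  (* Removing [u ^ i] frees the weight [w kk * i], which [phi kk ^+ i] takes up below; as [w kk] is
     positive, [i <= D] follows. *)
  have iD : (wdeg gwt (mnm_drop v m) + w kk * i <= D)%N by rewrite -[X in (_ + X)%N](_ : gwt v * i = _)%N // -wdeg_mnm_drop.
  have iM : (i <= M)%N.
    apply: leq_trans DM; apply: leq_trans iD; apply: leq_trans (leq_addl _ _).
    exact: leq_pmull.
  rewrite (mpolyX_mnm_drop B v) -/i.
  set R1 := \prod_j bit_factor j; set R2 := \prod_(j : 'I_s | (j < k)%N) _.
  set R3 := \prod_(g | _) _; set R4 := \prod_f _.
  have -> : 'X_[mnm_drop v m] * pvar B v ^+ i * (R1 * (gate_factor kk * R2) * R3 * R4) =
     pvar B v ^+ i * gate_factor kk * ('X_[mnm_drop v m] * R1 * R2 * R3 * R4) by exact: rearrange3.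
  have fphi (g : 'I_s) : (g <= k)%N -> vfree v (phi g).
    move=> gk; refine (@vfree_wle _ _ (gate_from g) _ _ _ (@phi_from g)).
    by rewrite /= gk.
  rewrite /gate_factor (xcoef_pow_elim (c := fun i => phi kk ^+ i)) //; first last.
  + rewrite /R1 /R2 /R3 /R4.
    repeat (apply: vfreeM); first exact: vfree_mnm_drop.
    * apply: vfree_prod => j _; apply: vfree_sum => l _; apply: vfreeM; first exact: vfree_nat.
      by apply: vfree_exp; apply: vfree_var.
    * apply: vfree_prod => g gk; apply: vfree_sum => l _; apply: vfreeM.
        by apply: vfree_exp; apply: fphi; apply: ltnW.
      apply: vfree_exp; apply: vfree_var; apply/eqP => -[jj].
      by move: gk; rewrite -jj /= ltnn.
    * apply: vfree_prod => j jk; apply: vfree_exp; apply: vfree_var; apply/eqP => -[jj].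
      by move: jk; rewrite -jj /= ltnn.
    * by apply: vfree_prod => j jk; apply: vfree_var.
  + by move=> l; apply: vfree_exp; apply: fphi.
  have -> : phi kk ^+ i * pvar B v ^+ M * ('X_[mnm_drop v m] * R1 * R2 * R3 * R4) =
     ('X_[mnm_drop v m] * phi kk ^+ i) * (R1 * R2 * (pvar B v ^+ M * R3) * R4) by exact: rearrange4.
  have -> : pvar B v ^+ M * R3 = \prod_(g : 'I_s | (k <= g)%N) gvar g ^+ M.
    by rewrite [RHS](bigD1 kk) //=; congr (_ * _); apply: eq_bigl => j; rewrite e2.
  rewrite IH; first last.
  + rewrite -[0%N]addn0; apply: wleM; last first.
      by rewrite -[0%N](muln0 i); apply: wle_exp; apply: phi_from.
    apply: wle_mon; move: fm; rewrite /wdeg !leqn0 !sum_nat_eq0 => /forallP fm.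
    apply/forallP => u /=; have := fm u; rewrite /= mnm_dropE; case: (u =P v) => [|/eqP uv]; first by rewrite muln0.
    case: u uv => [[j|g]|f] //= uv; rewrite !muln_eq0 => /orP[|->]; last by rewrite orbT.
    rewrite !eqb0 -!ltnNge ltnS leq_eqVlt => /orP[/eqP gk|->//].
    by case/eqP: uv; congr (inl (inr _)); apply: val_inj.
  + apply: wle_leq iD _; apply: wleM; first exact: wle_mon.
    by rewrite mulnC; apply: wle_exp; apply: phi_wt.
  + exact: ltnW.
  apply: eq_bigr => e _; rewrite !mevalM !rmorphXn /= phi_val; congr (_ * _ ^+ _).
  by rewrite mevalXU enum_rankK.
Qed.

Lemma xcoef_elimination (P : A) (D : nat) :
  (D <= M)%N -> wle gwt D P -> wle (gate_from s) 0 P ->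
  gcoef (P * ((\prod_j bit_factor j) * (\prod_g gate_factor g) * (\prod_f fvar f))) =
  \sum_e P.@[fun i => genv e (enum_val i)].
Proof.
move=> DM wP fP; rewrite -(xcoef_gates DM (leqnn s) wP fP).
rewrite [\prod_(g : 'I_s | (g < s)%N) gate_factor g](eq_bigl xpredT); last by move=> g; rewrite ltn_ord.
rewrite [\prod_(g : 'I_s | (s <= g)%N) _]big_pred0 ?mulr1 // => g.
by rewrite leqNgt ltn_ord.
Qed.

End Elimination.

(** * Coefficients as permanents *)

Definition permanent (B : comNzRingType) n (X : 'I_n -> 'I_n -> B) : B :=
  \sum_(s : 'S_n) \prod_i X i (s i).

Section ProductOfAffineForms.
Variables (V : finType) (B : comNzRingType).
Notation A := {mpoly B[#|V|]}.

Definition omon (o : option V) : 'X_{1..#|V|} :=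
  if o is Some v then U_(enum_rank v)%MM else 0%MM.

Lemma omon_inj : injective omon.
Proof.
move=> [v|] [w|] //=.
- by move/eqP; rewrite eq_mnm1 => /eqP/enum_rank_inj->.
- by move/eqP; rewrite mnm1_eq0.
- by move/esym/eqP; rewrite mnm1_eq0.
Qed.

Lemma affine_expand (l : A) : (forall m, m \in msupp l -> (mdeg m <= 1)%N) ->
  l = \sum_(o : option V) l@_(omon o) *: 'X_[omon o].
Proof.
move=> deg; apply/mpolyP => m; rewrite raddf_sum /=.
under eq_bigr => o _ do rewrite mcoeffZ mcoeffX.
have [ml|/memN_msupp_eq0 ml] := boolP (m \in msupp l); last first.
  rewrite ml big1 // => o _; case: eqP => [->|_]; first by rewrite ml mul0r.
  by rewrite mulr0.
have [o ->] : exists o, m = omon o.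
  have := deg m ml; rewrite leq_eqVlt ltnS leqn0 mdeg_eq0 => /orP[/mdeg1P[i /eqP->]|/eqP->].
    by exists (Some (enum_val i)); rewrite /= enum_valK.
  by exists None.
rewrite (bigD1 o) //= eqxx mulr1 big1 ?addr0 // => o' o'o.
by rewrite (inj_eq omon_inj) (negbTE o'o) mulr0.
Qed.

Lemma sum_omon_count n (h : 'I_n -> option V) v :
  (\sum_i omon (h i))%MM (enum_rank v) = count_mem (Some v) [seq h i | i <- enum 'I_n].
Proof.
rewrite mnm_sumE count_map -sum1_count big_enum_cond [RHS]big_mkcond /=.
apply: eq_bigr => i _; case: (h i) => [w|] /=; last by rewrite mnm0E.
rewrite mnm1E (inj_eq enum_rank_inj) -[Some w == Some v]/(w == v).
by case: eqP.
Qed.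

(** Fixes the multiplicity of the constant column: two lists of equal length that agree on every
    [Some v] also agree on [None]. *)
Lemma count_None (T : finType) (r : seq (option T)) :
  (count_mem None r + \sum_(v : T) count_mem (Some v) r = size r)%N.
Proof.
elim: r => [|[w|] r IH] /=.
- by rewrite big1.
- rewrite big_split /= add0n -IH.
  have -> : (\sum_(v : T) (Some w == Some v) = 1)%N.
    rewrite (bigD1 w) //= big1 ?eqxx // => v vw.
    by rewrite -[Some w == Some v]/(w == v) eq_sym (negbTE vw).
  by rewrite addnCA add1n.
- by rewrite -IH add1n addSn.
Qed.

(* The columns of the permanent list each variable [v] with multiplicity [a v],
   padded with copies of the constant column [None]; [c] counts the
   permutations fixing this list. *)
Lemma permanent_of_affine (N : nat) (rows : 'I_N -> A) (a : V -> nat) :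
  (forall i m, m \in msupp (rows i) -> (mdeg m <= 1)%N) ->
  (\sum_v a v <= N)%N ->
  exists (c : nat) (col : 'I_N -> option V), (0 < c)%N /\
    c%:R * xcoef a (\prod_i rows i) = permanent (fun i j => (rows i)@_(omon (col j))).
Proof.
move=> deg aN.
pose cs := flatten [seq nseq (a v) (Some v) | v <- enum V] ++ nseq (N - \sum_v a v) None.
have ccs v : count_mem (Some v) cs = a v.
  rewrite count_cat count_flatten -map_comp.
  rewrite (eq_map (g := fun w => ((w == v) * a w)%N)); last by move=> w /=; rewrite count_nseq.
  rewrite sumnE big_map big_enum /= (bigD1 v) //= eqxx mul1n big1 ?addn0.
    by rewrite count_nseq /= mul0n addn0.
  by move=> w /negbTE->; rewrite mul0n.
have scs : size cs == N.
  rewrite size_cat size_flatten /shape -map_comp sumnE big_map big_enum /=.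
  by under eq_bigr => v _ do rewrite size_nseq; rewrite size_nseq subnKC.
pose colt := Tuple scs.
pose col i := tnth colt i.
pose ent i o := (rows i)@_(omon o).
pose good (h : {ffun 'I_N -> option V}) := (\sum_i omon (h i))%MM == exp_mon a.
have goodP (h : {ffun 'I_N -> option V}) :
    good h <-> exists s : 'S_N, h = [ffun i => col (s i)].
  have -> : good h = perm_eq [seq h i | i <- enum 'I_N] cs.
    apply/eqP/idP => [E|/seq.permP E].
      have cE v : count_mem (Some v) [seq h i | i <- enum 'I_N] = count_mem (Some v) cs.
        by rewrite ccs -sum_omon_count E mnmE enum_rankK.
      apply/allP => -[v|] _ /=; first by rewrite cE.
      have := count_None cs; rewrite (eqP scs).
      have := count_None [seq h i | i <- enum 'I_N].
      rewrite size_map -cardE card_ord.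
      under eq_bigr => v _ do rewrite cE.
      by move=> E1 E2; apply/eqP; move: (etrans E1 (esym E2)) => /eqP; rewrite eqn_add2r => /eqP.
    apply/mnmP => i; rewrite -(enum_valK i) sum_omon_count E ccs mnmE.
    by rewrite enum_rankK.
  split.
    move=> pe; have /tuple_permP[s E] : perm_eq [seq h i | i <- enum 'I_N] colt by [].
    exists s; apply/ffunP => i; rewrite ffunE.
    have := congr1 (fun r => nth (h i) r i) E; rewrite (nth_map i) ?size_enum_ord //.
    rewrite nth_ord_enum => ->.
    by rewrite -(tnth_nth _ [tuple tnth colt (s i) | i < N]) tnth_mktuple.
  case=> s ->; apply/(@tuple_permP _ _ _ colt); exists s.
  by rewrite /=; apply: eq_map => i; rewrite ffunE.
pose stab := [set s : 'S_N | [ffun i => col (s i)] == [ffun i => col i]].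
exists #|stab|, col; split.
  by apply/card_gt0P; exists 1%g; rewrite inE; apply/eqP/ffunP => i; rewrite !ffunE perm1.
(* Expansion by choosing one term from each row; [good] selects the choices whose monomial is the
   extracted one. *)
have -> : xcoef a (\prod_i rows i) = \sum_(h : {ffun 'I_N -> option V} | good h) \prod_i ent i (h i).
  under eq_bigr => i _ do rewrite (affine_expand (@deg i)).
  rewrite bigA_distr_bigA /= raddf_sum /= [RHS]big_mkcond; apply: eq_bigr => h _.
  rewrite scaler_prod mprodXE xcoefZ /xcoef mcoeffX /good.
  by case: eqP => _; rewrite ?mulr1 ?mulr0.
(* Permutations are grouped by the columns they choose. A group is a coset [s0 * stab], so each good
   choice occurs [#|stab|] times. *)
rewrite /permanent (partition_big (fun s : 'S_N => [ffun i => col (s i)]) good) /=; last first.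
  by move=> s _; apply/goodP; exists s.
rewrite mulr_sumr; apply: eq_bigr => h gh.
rewrite [RHS](eq_bigr (fun=> \prod_i ent i (h i))); last first.
  by move=> s /eqP E; rewrite -E /=; apply: eq_bigr => i _; rewrite ffunE.
rewrite sumr_const mulr_natl; congr (_ *+ _).
case/goodP: gh => s0 ->.
rewrite -(card_imset stab (mulgI s0)); apply: eq_card => s.
apply/imsetP/(@eqP {ffun 'I_N -> option V} [ffun i => col (s i)] [ffun i => col (s0 i)]) => [[s' ]|].
  rewrite inE => /eqP E ->; apply/ffunP => i; rewrite !ffunE permM.
  by have := congr1 (fun f : {ffun 'I_N -> option V} => f (s0 i)) E; rewrite !ffunE.
move=> E; exists (s0^-1 * s)%g; last by rewrite mulKVg.
rewrite inE; apply/eqP/ffunP => i; rewrite !ffunE permM.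
have := congr1 (fun f : {ffun 'I_N -> option V} => f (s0^-1%g i)) E.
by rewrite !ffunE permKV.
Qed.

End ProductOfAffineForms.

(** * Exponential sums as permanents *)

Section AffineForms.
Variables (K : fieldType) (m p : nat).
Notation B := {mpoly K[m]}.
Notation A := {mpoly B[p]}.

(** The degrees in the extracted variables and in the remaining ones are bounded separately, because
    the entries of the permanent will be the coefficients [l@_mu]; a product of one variable of each
    kind is allowed. *)
Definition affine_form (l : A) : Prop :=
  (forall mu, mu \in msupp l -> (mdeg mu <= 1)%N) /\
  (forall mu, (msize (l@_mu) <= 2)%N).

Lemma affine_formD l1 l2 : affine_form l1 -> affine_form l2 -> affine_form (l1 + l2).
Proof.
move=> [d1 s1] [d2 s2]; split=> mu.
  by move/msuppD_le; rewrite mem_cat => /orP[/d1|/d2].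
by rewrite mcoeffD (leq_trans (msizeD_le _ _)) // geq_max s1 s2.
Qed.

Lemma affine_formZ (c : K) l : affine_form l -> affine_form (c%:MP *: l).
Proof.
move=> [d s]; split=> mu; first by move/msuppZ_le/d.
by rewrite mcoeffZ mul_mpolyC (leq_trans (msizeZ_le _ _)).
Qed.

Lemma affine_formN l : affine_form l -> affine_form (- l).
Proof. by move/(affine_formZ (-1)); rewrite mpolyCN mpolyC1 scaleN1r. Qed.

Lemma affine_formB l1 l2 : affine_form l1 -> affine_form l2 -> affine_form (l1 - l2).
Proof. by move=> h1 h2; apply/affine_formD/affine_formN. Qed.

Lemma affine_formC (b : B) : (msize b <= 2)%N -> affine_form b%:MP.
Proof.
move=> sb; split=> mu.
  by rewrite msuppC; case: eqP => // _; rewrite inE => /eqP->; rewrite mdeg0.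
by rewrite mcoeffC; case: eqP => _; rewrite ?mulr1 ?mulr0 ?msize0.
Qed.

Lemma affine_formK (c : K) : affine_form (c%:MP%:MP).
Proof. by apply: affine_formC; rewrite msizeC; case: (c != 0). Qed.

Lemma affine_form0 : affine_form 0.
Proof. by have := affine_formK 0; rewrite !mpolyC0. Qed.

Lemma affine_form1 : affine_form 1.
Proof. by have := affine_formK 1; rewrite !mpolyC1. Qed.

Lemma affine_formX i : affine_form 'X_i.
Proof.
split=> mu; first by rewrite msuppX inE => /eqP->; rewrite mdeg1.
by rewrite mcoeffX; case: eqP => _; rewrite ?msize1 ?msize0.
Qed.

Lemma affine_form_sum I (r : seq I) (F : I -> A) :
  (forall i, affine_form (F i)) -> affine_form (\sum_(i <- r) F i).
Proof.
by move=> h; elim/big_rec: _ => [|i x _ IH]; [apply: affine_form0|apply: affine_formD].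
Qed.
End AffineForms.

Section Traces.
Variables (K : fieldType) (n : nat).
Notation C := {mpoly K[n]}.

(* The weight of an entry bounds its degree; since weights are positive, the
   multiplicity of a gate in any monomial of a computation of degree [D] is at
   most [D]. *)
Inductive wtrace : seq (C * nat) -> Prop :=
  | wt_nil : wtrace [::]
  | wt_zero w L of (0 < w)%N & wtrace L : wtrace ((0, w) :: L)
  | wt_var i L of wtrace L : wtrace (('X_i, 1%N) :: L)
  | wt_lin c1 c2 (x y : C) (w : nat) (L : seq (C * nat)) of (x, w) \in L & (y, w) \in L & wtrace L :
      wtrace ((c1 *: x + c2 *: y, w) :: L)
  | wt_mul (x y : C) (w1 w2 : nat) (L : seq (C * nat)) of (x, w1) \in L & (y, w2) \in L & wtrace L :
      wtrace ((x * y, (w1 + w2)%N) :: L).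

Variant instr s : Type :=
  | IZero | IVar of 'I_n | ILin of K & K & 'I_s & 'I_s | IMul of 'I_s & 'I_s.

Definition instr_ok s (x : 'I_s -> C) (w : 'I_s -> nat) (g : 'I_s) (i : instr s) : Prop :=
  match i with
  | IZero => x g = 0
  | IVar i => x g = 'X_i /\ w g = 1%N
  | ILin c1 c2 a b => [/\ (a < g)%N, (b < g)%N, w a = w g, w b = w g &
                         x g = c1 *: x a + c2 *: x b]
  | IMul a b => [/\ (a < g)%N, (b < g)%N, w g = (w a + w b)%N & x g = x a * x b]
  end.

(** New entries are consed, so the reversed list numbers them by age and operands precede the gates
    that use them. *)
Definition tr_val L (g : 'I_(size L)) : C := (nth (0, 1%N) (rev L) g).1.
Definition tr_wt L (g : 'I_(size L)) : nat := (nth (0 : C, 1%N) (rev L) g).2.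

(** Traces are built with membership, which survives extension, while elimination works with
    positions; an operand gets the position of its oldest copy. *)
Lemma wtrace_instr L : wtrace L ->
  forall g : 'I_(size L), (0 < tr_wt g)%N /\ exists i, instr_ok (@tr_val L) (@tr_wt L) g i.
Proof.
have up (z : C * nat) L' (i : 'I_(size L')) :
    exists j : 'I_(size (z :: L')), j = i :> nat /\
      nth (0, 1%N) (rev (z :: L')) j = nth (0, 1%N) (rev L') i.
  exists (widen_ord (leqnSn _) i); split => //=.
  by rewrite rev_cons nth_rcons size_rev ltn_ord.
have mem (z : C * nat) L' u : u \in L' -> exists j : 'I_(size (z :: L')),
    (j < size L')%N /\ nth (0, 1%N) (rev (z :: L')) j = u.
  move=> uL; have iL : (index u (rev L') < size L')%N by rewrite -size_rev index_mem mem_rev.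
  have [j [ji E]] := up z L' (Ordinal iL).
  by exists j; rewrite E ji /= nth_index ?mem_rev.
have last (z : C * nat) L' (g : 'I_(size (z :: L'))) : g = size L' :> nat ->
    nth (0, 1%N) (rev (z :: L')) g = z.
  by move=> gE; rewrite rev_cons nth_rcons size_rev gE ltnn eqxx.
have pos L' : wtrace L' -> forall u, u \in L' -> (0 < u.2)%N.
  elim=> //= {L'}.
  - by move=> w L' w0 _ IH u; rewrite inE => /orP[/eqP->|/IH].
  - by move=> i L' _ IH u; rewrite inE => /orP[/eqP->|/IH].
  - by move=> c1 c2 x y w L' xL _ _ IH u; rewrite inE => /orP[/eqP->|/IH] //=; apply: (IH _ xL).
  - move=> x y w1 w2 L' xL _ _ IH u; rewrite inE => /orP[/eqP->|/IH] //=.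
    by rewrite addn_gt0 (IH _ xL).
move=> wL g; split.
  by apply: (pos _ wL); rewrite -mem_rev mem_nth // size_rev.
rewrite /tr_val /tr_wt.
have older (z : C * nat) L' (g' : 'I_(size (z :: L'))) :
    (forall g : 'I_(size L'), exists i, instr_ok (@tr_val L') (@tr_wt L') g i) ->
    (g' = size L' :> nat -> exists i, instr_ok (@tr_val (z :: L')) (@tr_wt (z :: L')) g' i) ->
    exists i, instr_ok (@tr_val (z :: L')) (@tr_wt (z :: L')) g' i.
  move=> IH; have := ltn_ord g'; rewrite /= ltnS leq_eqVlt => /orP[/eqP->|lt _]; first by apply.
  have [ins] := IH (Ordinal lt).
  have E' : nth (0, 1%N) (rev (z :: L')) g' = nth (0, 1%N) (rev L') (Ordinal lt).
    by rewrite rev_cons nth_rcons size_rev lt.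
  case: ins => [|i|c1 c2 a b|a b] /=.
  - by exists (IZero _); rewrite /= /tr_val E'.
  - by exists (IVar _ i); rewrite /= /tr_val /tr_wt E'.
  - have [a' [a1 a2]] := up z L' a; have [b' [b1 b2]] := up z L' b.
    by exists (ILin c1 c2 a' b'); rewrite /= /tr_val /tr_wt E' a2 b2 a1 b1.
  - have [a' [a1 a2]] := up z L' a; have [b' [b1 b2]] := up z L' b.
    by exists (IMul a' b'); rewrite /= /tr_val /tr_wt E' a2 b2 a1 b1.
elim: wL g => {L} [|w L w0 _ IH|i L _ IH|c1 c2 x y w L xL yL _ IH|x y w1 w2 L xL yL _ IH] g.
- by case: g.
- by apply: older => // /last E; exists (IZero _); rewrite /= /tr_val E.
- by apply: older => // /last E; exists (IVar _ i); rewrite /= /tr_val /tr_wt E.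
- apply: older => // gE.
  have [a [a1 a2]] := mem (c1 *: x + c2 *: y, w) _ _ xL.
  have [b [b1 b2]] := mem (c1 *: x + c2 *: y, w) _ _ yL.
  by exists (ILin c1 c2 a b); rewrite /= /tr_val /tr_wt a2 b2 (last _ _ _ gE) gE.
- apply: older => // gE.
  have [a [a1 a2]] := mem (x * y, (w1 + w2)%N) _ _ xL.
  have [b [b1 b2]] := mem (x * y, (w1 + w2)%N) _ _ yL.
  by exists (IMul a b); rewrite /= /tr_val /tr_wt a2 b2 (last _ _ _ gE) gE.
Qed.

End Traces.

Lemma monic_split_tuple (K : closedFieldType) (p : {poly K}) M :
  p \is monic -> size p = M.+1 ->
  exists r : M.-tuple K, p = \prod_(z <- r) ('X - z%:P).
Proof.
move=> /monicP lp sp; have [r] := closed_field_poly_normal p.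
rewrite lp scale1r => pE.
have sr : size r == M by have := sp; rewrite pE size_prod_XsubC => -[->].
by exists (Tuple sr).
Qed.

Lemma monic_unit_coef_poly (R : nzRingType) M (c : nat -> R) :
  c M = 1 -> \poly_(i < M.+1) c i \is monic /\ size (\poly_(i < M.+1) c i) = M.+1.
Proof.
move=> cM; have sM : size (\poly_(i < M.+1) c i) = M.+1.
  by rewrite size_poly_eq // cM oner_neq0.
by split=> //; rewrite monicE lead_coefE sM coef_poly ltnSn cM.
Qed.

Lemma affine_triple_gadget (V : finType) (K : fieldType) m (w1 w2 w3 : V)
    (x y z : {mpoly {mpoly K[m]}[#|V|]}) :
  affine_form x -> affine_form y -> affine_form z ->
  forall l, l \in triple_gadget w1 w2 w3 x y z -> affine_form l.
Proof.
move=> ax ay az l; have aX v : affine_form (pvar {mpoly K[m]} v : {mpoly _[#|V|]}) by apply: affine_formX.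
have a1 := @affine_form1 K m #|V|.
rewrite /triple_gadget; move: (aX w1) (aX w2) (aX w3).
move: (pvar _ w1) (pvar _ w2) (pvar _ w3) => W1 W2 W3 a2 a3 a4.
by rewrite !in_cons orbF; do ?[case/orP]; move/eqP->;
  repeat lazymatch goal with
  | |- affine_form (_ - _) => apply: affine_formB
  | |- affine_form (_ + _) => apply: affine_formD
  | |- _ => assumption
  end.
Qed.

Section Replace.
Variables (V I : finType) (B : comNzRingType) (a : V -> nat) (pr : V -> option I).
Notation A := {mpoly B[#|V|]}.
Variables (F G : I -> A).
Hypothesis FG : forall i Q, (forall v, pr v = Some i -> vfree v Q) ->
  xcoef a (F i * Q) = xcoef a (G i * Q).
Hypothesis Ffree : forall i v j, pr v = Some j -> j != i -> vfree v (F i).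
Hypothesis Gfree : forall i v j, pr v = Some j -> j != i -> vfree v (G i).

(** [F i] and [G i] are interchangeable only next to a cofactor free of the variables owned by [i].
    Exchanging one factor at a time respects this, since every other factor, replaced or not, is
    free of them. *)
Lemma xcoef_replace_factors (r : seq I) (Q : A) : uniq r ->
  (forall v i, i \in r -> pr v = Some i -> vfree v Q) ->
  xcoef a (Q * \prod_(i <- r) F i) = xcoef a (Q * \prod_(i <- r) G i).
Proof.
elim: r Q => [|i r IH] Q; first by rewrite !big_nil.
move=> /= /andP[ir ur] fQ; rewrite !big_cons mulrA IH //; last first.
  move=> v j jr pj; apply: vfreeM; first by apply: fQ pj; rewrite inE jr orbT.
  by apply: Ffree pj _; apply: contraNneq ir => <-.
rewrite -mulrA mulrCA FG; first by rewrite mulrCA.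
move=> v pi.
apply: vfreeM; first by apply: fQ pi; rewrite inE eqxx.
rewrite big_seq; apply: vfree_prod => j jr; apply: Gfree pi _.
by apply: contraNneq ir => ->.
Qed.
End Replace.

Section ExponentialSum.
Variables (K : numClosedFieldType) (m t : nat) (L : seq ({mpoly K[m + t]} * nat)) (D : nat).
Hypothesis wL : wtrace L.
Notation s := (size L).
Notation M := D.+1.
Notation F := ('I_s * 'I_M * 'I_7)%type.
Notation V := ('I_t + 'I_s + F)%type.
Notation B := {mpoly K[m]}.
Notation A := {mpoly B[#|{: V}|]}.
Notation val := (fun (e : {ffun 'I_t -> bool}) (g : 'I_s) => subst_bits e (tr_val g)).
Notation w := (@tr_wt K (m + t) L).
Notation uvar := (@gvar B t s F).
Notation pv g j i := (inr (g, j, i) : V).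
Notation a := (@gexp t s M F).

(** A common interface for affine gates and products: [phi] is the gate in terms of older variables,
    and [rows j] are the affine forms that stand for the factor [phi - z j * u] of its
    [gate_factor]. *)
Definition gate_cert (z : 'I_M -> K) (g : 'I_s) (cr : A * ('I_M -> seq A)) : Prop :=
  let: (phi, rows) := cr in
  [/\ wle (@gwt t s F w) (w g) phi,
      wle (@gate_from t s F g) 0 phi,
      (forall e, phi.@[fun i => genv val e (enum_val i)] = val e g),
      (forall j l, l \in rows j -> affine_form l) &
      [/\ (forall j, (size (rows j) <= 14)%N),
          (forall j Q, (forall i, vfree (pv g j i) Q) ->
             xcoef a ((\prod_(l <- rows j) l) * Q) =
             xcoef a ((phi - (z j)%:MP *: uvar g) * (\prod_i pvar B (pv g j i)) * Q)) &
          (forall j f, f.1 != (g, j) -> vfree (inr f : V) (\prod_(l <- rows j) l))]].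

Lemma subst_bitsX e (i : 'I_(m + t)) :
  subst_bits e ('X_i : {mpoly K[m + t]}) =
  match split i with inl j => 'X_j | inr j => (e j)%:R end.
Proof. by rewrite /subst_bits comp_mpolyXU -tnth_nth tnth_mktuple. Qed.

(** Here [phi - z u] is itself a row. The seven auxiliary variables are added as rows of their own,
    so that every slot leaves the same monomial as a product gate does. *)
Lemma affine_cert z g (phi : A) :
  wle (@gwt t s F w) (w g) phi -> wle (@gate_from t s F g) 0 phi ->
  (forall e, phi.@[fun i => genv val e (enum_val i)] = val e g) ->
  affine_form phi ->
  exists cr, gate_cert z g cr.
Proof.
move=> h1 h2 h3 aff.
exists (phi, fun j => (phi - (z j)%:MP *: uvar g) :: [seq pvar B (pv g j i) | i <- enum 'I_7]).
have fphi f : vfree (inr f : V) phi by apply: vfree_wle h2.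
split=> //.
  move=> j l; rewrite inE => /orP[/eqP->|/mapP[i _ ->]]; last exact: affine_formX.
  by apply: affine_formB => //; apply: affine_formZ; apply: affine_formX.
split.
- by move=> j; rewrite /= size_map size_enum_ord.
- by move=> j Q _; rewrite big_cons big_map big_enum.
move=> j f fgj; rewrite big_cons big_map big_enum; apply: vfreeM.
  by apply: vfreeB => //; apply: vfreeZ; apply: vfree_var.
apply: vfree_prod => i _; apply: vfree_var; apply: contraNneq fgj => -[->].
by [].
Qed.

Lemma gate_cert_exists z g : exists cr, gate_cert z g cr.
Proof.
have [w0 [ins]] := wtrace_instr wL g.
have uval e h : (uvar h).@[fun i => genv val e (enum_val i)] = val e h.
  by rewrite mevalXU enum_rankK.
have uw h : wle (@gwt t s F w) (w h) (uvar h) by apply: wle_var.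
have uf (h : 'I_s) : (h < g)%N -> wle (@gate_from t s F g) 0 (uvar h).
  move=> hg; have E0 : @gate_from t s F g (inl (inr h)) = 0%N by rewrite /= leqNgt hg.
  by rewrite -[0%N]E0; apply: wle_var.
case: ins => [|i|c1 c2 x y|x y] /=.
- move=> g0; apply: (@affine_cert z g 0); try exact: wle0.
    by move=> e; rewrite meval0 g0 /subst_bits raddf0.
  exact: affine_form0.
(* A coordinate [x_j] lives in the coefficient ring and has weight 0; a bit is an extracted variable
   of weight 1, the weight of its gate. *)
- case=> gi wg; case E: (split i) => [j|j].
    apply: (@affine_cert z g ('X_j)%:MP).
    + by rewrite wg; apply: (@wle_leq _ _ _ 0); last exact: wleC.
    + exact: wleC.
    + by move=> e; rewrite mevalC gi subst_bitsX E.
    + by apply: affine_formC; rewrite msizeX mdeg1.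
  apply: (@affine_cert z g (@bvar B t s F j)).
  + by rewrite wg; apply: wle_var.
  + exact: wle_var.
  + by move=> e; rewrite mevalXU enum_rankK gi subst_bitsX E.
  + exact: affine_formX.
- case=> xg yg wx wy gE; apply: (@affine_cert z g (c1%:MP *: uvar x + c2%:MP *: uvar y)).
  + by apply: wleD; apply: wleZ; [rewrite -wx|rewrite -wy]; apply: uw.
  + by apply: wleD; apply: wleZ; apply: uf.
  + move=> e; rewrite mevalD !mevalZ !uval gE /subst_bits.
    by rewrite raddfD /= !comp_mpolyZ !mul_mpolyC.
  + by apply: affine_formD; apply: affine_formZ; apply: affine_formX.
case=> xg yg wg gE.
pose h : B := (8%:R^-1)%:MP.
have h8 : 8%:R * h = 1.
  by rewrite /h -mpolyC_nat -mpolyCM mulfV ?mpolyC1 // pnatr_eq0.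
exists (uvar x * uvar y, fun j => slot_rows (z j)%:MP h (fun i => pv g j i)
    (inl (inr g) : V) (inl (inr x)) (inl (inr y))).
split.
- by rewrite wg; apply: wleM.
- by rewrite -[0%N]addn0; apply: wleM; apply: uf.
- by move=> e; rewrite mevalM !uval gE /subst_bits rmorphM.
- have affX := @affine_formX K m #|{: V}|.
  move=> j l; rewrite mem_cat => /orP[]; apply: affine_triple_gadget; try exact: affX.
    by rewrite /h -mpolyCM -mpolyCN; apply: affine_formK.
  by rewrite /h; apply: affine_formZ; exact: affX.
split.
- by [].
- move=> j Q fQ; rewrite xcoef_slot_rows //.
  + by move=> i i' [].
move=> j f fgj; rewrite /slot_rows big_cat /=.
have nf i : (inr f : V) != pv g j i by apply: contraNneq fgj => -[->].
by apply: vfreeM; apply: vfree_triple_gadget;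
  [exact: nf|exact: nf|exact: nf|exact/vfree_var/nf|exact: vfree_var|exact: vfreeC
  |exact: nf|exact: nf|exact: nf|exact/vfreeZ/vfree_var/nf|exact: vfree_var|exact: vfree_var].
Qed.

(** [c M = 1] makes the polynomial monic of degree [M], so over a closed field it has [M] roots, one
    for each slot of a gate or factor of a bit. *)
Lemma homogenized_product (S : comNzRingType) (iota : {rmorphism K -> S}) (c : nat -> nat) :
  c M = 1%N -> exists r : 'I_M -> K, forall x y : S,
    \sum_(i < M.+1) (c i)%:R * (x ^+ i * y ^+ (M - i)) = \prod_(j < M) (x - iota (r j) * y).
Proof.
move=> cM; have [] := @monic_unit_coef_poly K M (fun i => (c i)%:R); first by rewrite cM.
move=> exp_mon sz; have [r E] := monic_split_tuple exp_mon sz.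
exists (tnth r) => x y.
have := homogenize_roots iota r x y; rewrite -E size_tuple [in RHS]big_tuple => <-.
by apply: eq_bigr => i _; rewrite coef_poly ltn_ord rmorph_nat.
Qed.

(** The product of all rows has the exponential sum as one coefficient, which [permanent_of_affine]
    turns into a permanent; [c] is the inverse of the multiplicity found there. *)
Theorem exponential_sum_permanent (outs : seq 'I_s) (c0 : K) :
  (forall g, g \in outs -> (w g <= D)%N) ->
  exists (N : nat) (X : 'I_N -> 'I_N -> B) (c : K),
    [/\ (0 < N <= 1 + 2 * t * M + 22 * s * M)%N,
        (forall i j, (msize (X i j) <= 2)%N) &
        \sum_(e : {ffun 'I_t -> bool}) subst_bits e (c0%:MP + \sum_(g <- outs) tr_val g) =
        c%:MP * permanent X].
Proof.
move=> outD.
pose iota : {rmorphism K -> A} := ((@mpolyC #|{: V}| B) \o (@mpolyC m K)).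
have [z zE] := @homogenized_product A iota (fun=> 1%N) erefl.
(* The condition is [bit_moment M = 1], which fails at [M = 0]; with [M = D.+1] it also holds for
   [D = 0]. *)
have [z' z'E] := @homogenized_product A iota bit_moment erefl.
have [cr crP] := fin_all_exists (gate_cert_exists z).
pose phi g := (cr g).1; pose rows g := (cr g).2.
have phi_wt g : wle (@gwt t s F w) (w g) (phi g).
  by have := crP g; rewrite /phi; case: (cr g) => ? ? [].
have phi_from (g : 'I_s) : wle (@gate_from t s F g) 0 (phi g).
  by have := crP g; rewrite /phi; case: (cr g) => ? ? [].
have phi_val e g : (phi g).@[fun i => genv val e (enum_val i)] = val e g.
  by have := crP g; rewrite /phi; case: (cr g) => ? ? [].
have rows_aff g j l : l \in rows g j -> affine_form l.
  by have := crP g; rewrite /rows; case: (cr g) => ? ? [_ _ _ h _]; apply: h.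
have rows_size g j : (size (rows g j) <= 14)%N.
  by have := crP g; rewrite /rows; case: (cr g) => ? ? [_ _ _ _ [h _ _]]; apply: h.
have rows_cf g j Q : (forall i, vfree (pv g j i) Q) ->
   xcoef a ((\prod_(l <- rows g j) l) * Q) =
   xcoef a ((phi g - (z j)%:MP *: uvar g) * (\prod_i pvar B (pv g j i)) * Q).
  by have := crP g; rewrite /rows /phi; case: (cr g) => ? ? [_ _ _ _ [_ h _]]; apply: h.
have rows_free g j f : f.1 != (g, j) -> vfree (inr f : V) (\prod_(l <- rows g j) l).
  by have := crP g; rewrite /rows; case: (cr g) => ? ? [_ _ _ _ [_ _ h]]; apply: h.
have w_gt0 g : (0 < w g)%N by have [] := wtrace_instr wL g.
pose P0 : A := (c0%:MP)%:MP + \sum_(g <- outs) uvar g.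
pose brows : seq A :=
  flatten [seq [seq 1 - iota (z' i) * @bvar B t s F j | i <- enum 'I_M] | j <- enum 'I_t].
pose grows : seq A := flatten [seq rows gj.1 gj.2 | gj <- enum {: 'I_s * 'I_M}].
(* The rows equal to 1 leave the product unchanged and make room for as many columns as the total
   exponent [\sum_v a v]. *)
pose all_rows := P0 :: brows ++ grows ++ nseq (\sum_v a v) 1.
have P0_wt : wle (@gwt t s F w) D P0.
  apply: wleD; first by apply: (@wle_leq _ _ _ 0); last exact: wleC.
  rewrite big_seq; apply: wle_sum => g /outD gD; apply: wle_leq gD _; exact: wle_var.
have P0_from : wle (@gate_from t s F s) 0 P0.
  apply: wleD; first exact: wleC.
  apply: wle_sum => g _; have E0 : @gate_from t s F s (inl (inr g)) = 0%N by rewrite /= leqNgt ltn_ord.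
  by rewrite -[0%N]E0; apply: wle_var.
have total : xcoef a (\prod_(l <- all_rows) l) =
    \sum_e subst_bits e (c0%:MP + \sum_(g <- outs) tr_val g).
  transitivity (\sum_e P0.@[fun i => genv val e (enum_val i)]); last first.
    apply: eq_bigr => e _; rewrite /subst_bits mevalD mevalC raddfD /= comp_mpolyC.
    congr (_ + _); rewrite !raddf_sum /=; apply: eq_bigr => g _.
    by rewrite mevalXU enum_rankK.
  rewrite -(xcoef_elimination w_gt0 phi_wt phi_from phi_val (leqnSn D) P0_wt P0_from).
  rewrite /all_rows big_cons !big_cat /= [\prod_(l <- nseq _ _) l]big1_seq ?mulr1; last first.
    by move=> l /andP[_]; rewrite mem_nseq => /andP[_ /eqP].
  have -> : \prod_(l <- brows) l = \prod_j @bit_factor B t s M F j.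
    rewrite /brows big_flatten big_map big_enum /=; apply: eq_bigr => j _.
    rewrite big_map big_enum /= -z'E /bit_factor; apply: eq_bigr => i _.
    by rewrite expr1n mul1r.
  have -> : \prod_(l <- grows) l = \prod_(gj : 'I_s * 'I_M) \prod_(l <- rows gj.1 gj.2) l.
    by rewrite /grows big_flatten big_map big_enum.
  pose FF (gj : 'I_s * 'I_M) := \prod_(l <- rows gj.1 gj.2) l.
  pose GG (gj : 'I_s * 'I_M) :=
    (phi gj.1 - (z gj.2)%:MP *: uvar gj.1) * (\prod_i pvar B (pv gj.1 gj.2 i)).
  (* [pr] names the slot that owns an auxiliary variable; bits and gates have no owner. *)
  pose pr (v : V) := if v is inr f then Some f.1 else None.
  rewrite mulrA (@xcoef_replace_factors _ _ _ a pr FF GG); first last.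
  - move=> [[j|g]|f] i //= _ _; apply: vfreeM.
      apply: vfreeD; first exact: vfreeC.
      by apply: vfree_sum => g _; apply: vfree_var.
    by apply: vfree_prod => j _; apply: vfree_sum => i' _; apply: vfreeM;
      [exact: vfree_nat|apply: vfree_exp; apply: vfree_var].
  - exact: index_enum_uniq.
  - move=> gj [[j|g]|f] i //= [<-] fgj; apply: vfreeM.
      apply: vfreeB; first by apply: vfree_wle (phi_from gj.1).
      by apply: vfreeZ; apply: vfree_var.
    apply: vfree_prod => k _; apply: vfree_var; apply: contraNneq fgj => -[->].
    by case: gj.
  - by move=> [g j] [[j'|g']|f] i //= [<-] fgj; apply: rows_free.
  - move=> [g j] Q fQ; rewrite /FF /GG /= rows_cf // => i; exact: fQ.
  rewrite -!mulrA; congr (xcoef _ (_ * (_ * _))).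
  rewrite /GG big_split /=; congr (_ * _).
    rewrite -(pair_bigA _ (fun g j => phi g - (z j)%:MP *: uvar g)) /=.
    apply: eq_bigr => g _; rewrite /gate_factor.
    transitivity (\prod_(j < M) (phi g - iota (z j) * uvar g)).
      by apply: eq_bigr => j _; rewrite mul_mpolyC.
    by rewrite -zE; apply: eq_bigr => i _; rewrite mul1r.
  rewrite (pair_bigA _ (fun gj i => pvar B (pv gj.1 gj.2 i))) /=.
  by apply: eq_bigr => -[[g j] i] _.
have aff l : l \in all_rows -> affine_form l.
  rewrite inE mem_cat mem_cat => /or4P[/eqP->|/flattenP[r /mapP[j _ ->] /mapP[i _ ->]]||].
  - apply: affine_formD; first exact: affine_formK.
    by apply: affine_form_sum => g; apply: affine_formX.
  - apply: affine_formB; first exact: affine_form1.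
    by rewrite mul_mpolyC; apply: affine_formZ; apply: affine_formX.
  - by case/flattenP => r /mapP[gj _ ->]; apply: rows_aff.
  - by rewrite mem_nseq => /andP[_ /eqP->]; apply: affine_form1.
pose N := size all_rows.
have suma : (\sum_v a v = t * M + s * M + 7 * (s * M))%N.
  rewrite big_sumType big_sumType /= !sum_nat_const !card_prod !card_ord muln1 (mulnC 7).
  by [].
have [||c [col [c0' cE]]] := @permanent_of_affine _ B N (tnth (in_tuple all_rows)) a.
- by move=> i mu; have [h _] := aff _ (mem_tnth i (in_tuple all_rows)); apply: h.
- rewrite /N /all_rows /= !size_cat size_nseq -addSn addnA.
  exact: leq_addl.
exists N, (fun i j => (tnth (in_tuple all_rows) i)@_(omon (col j))), (c%:R^-1); split.
(* Per slot there are at most 14 rows and 8 rows of padding, one for a copy of the gate variable and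
   seven for the auxiliary variables: hence 22. Each factor of a bit counts twice, as a row and as
   padding. *)
- rewrite /N /= !size_cat size_nseq suma.
  have -> : size brows = (t * M)%N.
    rewrite size_flatten /shape -map_comp sumnE big_map big_enum /=.
    under eq_bigr => j _ do rewrite size_map size_enum_ord.
    by rewrite sum_nat_const card_ord.
  have : (size grows <= 14 * (s * M))%N.
    rewrite size_flatten /shape -map_comp sumnE big_map big_enum /=.
    rewrite (_ : (14 * (s * M))%N = \sum_(gj : 'I_s * 'I_M) 14)%N; last first.
      by rewrite sum_nat_const card_prod !card_ord mulnC.
    by apply: leq_sum => gj _; apply: rows_size.
  move: (size grows) => q; rewrite -!mulnA; move: (t * M)%N (s * M)%N => x y qle.
  clear -qle; lia.
- by move=> i j; have [_ h] := aff _ (mem_tnth i (in_tuple all_rows)); apply: h.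
rewrite -total -cE -(big_tnth _ _ all_rows xpredT id) mulrA -mpolyC_nat -mpolyCM mulVf.
  by rewrite mpolyC1 mul1r.
by rewrite pnatr_eq0 -lt0n.
Qed.

End ExponentialSum.

(** * Circuits *)

Section Reach.
Variables (T : eqType) (tr : seq T -> Prop).

(** Quantifying over all extensions [L0] makes costs additive: the second operand is computed on the
    trace that the first has already extended. *)
Definition reach (L : seq T) (k : nat) (x : T) : Prop :=
  forall L0, tr L0 -> {subset L <= L0} ->
  exists L1, [/\ tr L1, {subset L0 <= L1}, x \in L1 & (size L1 <= size L0 + k)%N].

Lemma reach_mem L x : x \in L -> reach L 0 x.
Proof. by move=> xL L0 t0 s0; exists L0; split; rewrite ?addn0 //; apply: s0. Qed.

Lemma reach_leq L k1 k2 x : (k1 <= k2)%N -> reach L k1 x -> reach L k2 x.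
Proof.
move=> le12 r L0 t0 s0; have [L1 [t1 s1 x1 z1]] := r L0 t0 s0.
by exists L1; split => //; apply: leq_trans z1 _; rewrite leq_add2l.
Qed.

Lemma reach_step2 L k1 k2 x1 x2 y : reach L k1 x1 -> reach L k2 x2 ->
  (forall L0, tr L0 -> x1 \in L0 -> x2 \in L0 -> tr (y :: L0)) -> reach L (k1 + k2).+1 y.
Proof.
move=> r1 r2 st L0 t0 s0; have [L1 [t1 s1 m1 z1]] := r1 L0 t0 s0.
have [|L2 [t2 s2 m2 z2]] := r2 L1 t1; first by move=> z /s0 /s1.
exists (y :: L2); split.
- by apply: st => //; apply: s2.
- by move=> z /s1 /s2 z'; rewrite inE z' orbT.
- exact: mem_head.
- by rewrite /= addnS ltnS addnA (leq_trans z2) // leq_add2r.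
Qed.

Lemma reach_all L k (ts : seq T) : (forall x, x \in ts -> reach L k x) ->
  forall L0, tr L0 -> {subset L <= L0} ->
  exists L1, [/\ tr L1, {subset L0 <= L1}, {subset ts <= L1} &
                 (size L1 <= size L0 + size ts * k)%N].
Proof.
move=> r; elim: ts r => [|x ts IH] r L0 t0 s0.
  by exists L0; split; rewrite ?addn0.
have [L1 [t1 s1 m1 z1]] := r x (mem_head _ _) L0 t0 s0.
have [||L2 [t2 s2 m2 z2]] := IH _ L1 t1.
- by move=> y yts; apply: r; rewrite inE yts orbT.
- by move=> z /s0 /s1.
exists L2; split=> //.
- by move=> z /s1 /s2.
- by move=> z; rewrite inE => /orP[/eqP->|/m2//]; apply: s2.
- by rewrite /= mulSn addnA (leq_trans z2) // leq_add2r.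
Qed.
End Reach.

Section CircuitEval.
Variables (K X : Type).

Lemma gates_wf_rcons pos (s : seq (gate K X)) g :
  gates_wf pos (rcons s g) = gates_wf pos s && gate_wf (pos + size s) g.
Proof.
elim: s pos => [|h s IH] pos /=; first by rewrite addn0 andbT.
by rewrite IH andbA addSnnS.
Qed.

Lemma gate_values_rcons (A : nzRingType) (const : K -> A) (env : X -> A) s g :
  gate_values const env (rcons s g) =
  rcons (gate_values const env s) (gate_eval const env (gate_values const env s) g).
Proof. by rewrite /gate_values foldl_rcons. Qed.

Lemma size_gate_values (A : nzRingType) (const : K -> A) (env : X -> A) s :
  size (gate_values const env s) = size s.
Proof.
by elim/last_ind: s => // s g IH; rewrite gate_values_rcons !size_rcons IH.
Qed.

Lemma circuit_eval_morph (A A' : nzRingType) (f : {rmorphism A -> A'})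
    (const : K -> A) (env : X -> A) (const' : K -> A') (env' : X -> A') c :
  (forall a, const' a = f (const a)) -> (forall x, env' x = f (env x)) ->
  f (circuit_eval const env c) = circuit_eval const' env' c.
Proof.
move=> constE envE; rewrite /circuit_eval.
have valE s : gate_values const' env' s = map f (gate_values const env s).
  elim/last_ind: s => // s g IH; rewrite !gate_values_rcons map_rcons IH; congr rcons.
  have nthE (v : seq A) i : (map f v)`_i = f v`_i.
    have [iv|iv] := ltnP i (size v); first by rewrite (nth_map 0).
    by rewrite !nth_default ?size_map // rmorph0.
  by case: g => [x|a|i j|i j] /=; rewrite ?nthE ?rmorphD ?rmorphM.
by rewrite valE; have := last_map f (gate_values const env (gates c)) 0; rewrite rmorph0.
Qed.

Lemma gate_values_ind (A : nzRingType) (const : K -> A) (env : X -> A)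
    (I : nat -> seq A -> Prop) :
  I 0%N [::] ->
  (forall vals g, I (size vals) vals -> gate_wf (size vals) g ->
     I (size vals).+1 (rcons vals (gate_eval const env vals g))) ->
  forall s, gates_wf 0 s -> I (size s) (gate_values const env s).
Proof.
move=> I0 IS; elim/last_ind => // s g IH; rewrite gates_wf_rcons add0n => /andP[ws wg].
rewrite gate_values_rcons size_rcons -(size_gate_values const env s).
by apply: IS; rewrite size_gate_values //; apply: IH.
Qed.

End CircuitEval.

(** * Homogeneous components of a circuit *)

Section WeightedTraceOfCircuit.
Variables (K : fieldType) (n : nat) (D : nat).
Notation C := {mpoly K[n]}.
Notation reachw := (reach (@wtrace K n)).

Lemma reachw_lin L k1 k2 c1 c2 (x y : C) (w : nat) :
  reachw L k1 (x, w) -> reachw L k2 (y, w) -> reachw L (k1 + k2).+1 (c1 *: x + c2 *: y, w).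
Proof. by move=> r1 r2; apply: reach_step2 r1 r2 _ => L0 t0 m1 m2; apply: wt_lin. Qed.

Lemma reachw_mul L k1 k2 (x y : C) (w1 w2 : nat) :
  reachw L k1 (x, w1) -> reachw L k2 (y, w2) -> reachw L (k1 + k2).+1 (x * y, (w1 + w2)%N).
Proof. by move=> r1 r2; apply: reach_step2 r1 r2 _ => L0 t0 m1 m2; apply: wt_mul. Qed.

Lemma reachw_zero L (w : nat) : (0 < w)%N -> reachw L 1 (0, w).
Proof.
move=> w0 L0 t0 s0; exists ((0, w) :: L0); split; rewrite ?mem_head //=.
- exact: wt_zero.
- by move=> z zL; rewrite inE zL orbT.
- by rewrite addn1.
Qed.

Lemma reachw_var L i : reachw L 1 ('X_i, 1%N).
Proof.
move=> L0 t0 s0; exists (('X_i, 1%N) :: L0); split; rewrite ?mem_head //=.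
- exact: wt_var.
- by move=> z zL; rewrite inE zL orbT.
- by rewrite addn1.
Qed.

Lemma reachw_sum L k (w : nat) (f : nat -> C) q x : reachw L k (x, w) ->
  (forall i, (i < q)%N -> reachw L 1 (f i, w)) ->
  reachw L (k + 2 * q) (x + \sum_(i < q) f i, w).
Proof.
move=> rx; elim: q => [|q IH] rf; first by rewrite big_ord0 addr0 addn0.
rewrite big_ord_recr /=.
have -> : x + (\sum_(i < q) f i + f q) = 1 *: (x + \sum_(i < q) f i) + 1 *: f q.
  by rewrite !scale1r addrA.
rewrite (_ : (k + 2 * q.+1 = (k + 2 * q + 1).+1)%N); last by lia.
apply: reachw_lin; last exact: rf.
by apply: IH => i iq; apply: rf; apply: leqW.
Qed.

(** Each input is multiplied by a grading variable, so the coefficient of degree [d] of a gate is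
    its homogeneous component of degree [d]. *)
Let pconst (a : K) : {poly C} := (a%:MP)%:P.
Let penv (i : 'I_n) : {poly C} := ('X_i)%:P * 'X.

(** The component of degree 0 is a scalar and stays out of the trace; those of degree [1 .. D] take
    their degree as weight, and each costs at most [2 * D + 1] entries. *)
Lemma wtrace_of_gates (gs : seq (gate K 'I_n)) : gates_wf 0 gs ->
  exists L, [/\ wtrace L, (size L <= size gs * (D * (2 * D + 1)))%N &
    forall j, (j < size gs)%N ->
      (exists c : K, (gate_values pconst penv gs)`_j`_0 = c%:MP) /\
      (forall d, (0 < d <= D)%N -> ((gate_values pconst penv gs)`_j`_d, d) \in L)].
Proof.
pose I := fun (sz : nat) (vals : seq {poly C}) =>
  exists L, [/\ wtrace L, (size L <= sz * (D * (2 * D + 1)))%N &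
    forall j, (j < sz)%N -> (exists c : K, vals`_j`_0 = c%:MP) /\
      (forall d, (0 < d <= D)%N -> (vals`_j`_d, d) \in L)].
apply: (@gate_values_ind _ _ _ pconst penv I).
  by exists [::]; split=> //; apply: wt_nil.
move=> vals g [L [tL sL cL]] wg.
set v := gate_eval pconst penv vals g.
suff [c0 rv] : (exists c : K, v`_0 = c%:MP) /\
    (forall d, (0 < d <= D)%N -> reachw L (2 * D + 1) (v`_d, d)).
  pose ts := [seq (v`_d, d) | d <- iota 1 D].
  have [|L1 [t1 s1 m1 z1]] := @reach_all _ _ L (2 * D + 1) ts _ L tL (fun _ h => h).
  - by move=> x /mapP[d]; rewrite mem_iota add1n ltnS => dD ->; apply: rv.
  exists L1; split=> //.
    by apply: leq_trans z1 _; rewrite size_map size_iota mulSn addnC leq_add2l.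
  move=> j; rewrite ltnS leq_eqVlt => /orP[/eqP->|js].
    rewrite nth_rcons ltnn eqxx; split=> // d dD; apply: m1.
    by apply/mapP; exists d => //; rewrite mem_iota add1n ltnS.
  rewrite nth_rcons js; have [h1 h2] := cL j js; split=> // d dD.
  exact/s1/h2.
case: g wg @v => [i|a|i j|i j] /= wg.
- split; first by exists 0; rewrite coefMX /= mpolyC0.
  move=> d dD; apply: (@reach_leq _ _ _ 1); first by lia.
  rewrite coefMX coefC; case: d dD => [|[|d]] //= dD.
    exact: reachw_var.
  exact: reachw_zero.
- split; first by exists a; rewrite coefC.
  move=> d /andP[d0 dD]; apply: (@reach_leq _ _ _ 1); first by lia.
  by rewrite coefC gtn_eqF //; apply: reachw_zero.
- case/andP: wg => /cL[[ci Ei] ri] /cL[[cj Ej] rj]; split.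
    by exists (ci + cj); rewrite coefD Ei Ej mpolyCD.
  move=> d dD; apply: (@reach_leq _ _ _ 1); first by lia.
  rewrite coefD -[X in X + _]scale1r -[X in _ + X]scale1r.
  by apply: (@reachw_lin _ 0 0); apply: reach_mem; [apply: ri|apply: rj].
- case/andP: wg => /cL[[ci Ei] ri] /cL[[cj Ej] rj]; split.
    by exists (ci * cj); rewrite coef0M Ei Ej mpolyCM.
  case=> // d dD.
  (* The two ends of the convolution have a scalar factor and form a linear combination of weight
     [d.+1]; all other terms are products of entries of positive weight. *)
  have -> : (vals`_i * vals`_j)`_d.+1 = ci *: vals`_j`_d.+1 + cj *: vals`_i`_d.+1 +
      \sum_(q < d) vals`_i`_q.+1 * vals`_j`_(d.+1 - q.+1).
    rewrite coefM big_ord_recl /= subn0 Ei big_ord_recr /= /bump leq0n add1n subnn Ej.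
    by rewrite mul_mpolyC [_ * cj%:MP]mulrC mul_mpolyC addrA addrAC.
  apply: (@reach_leq _ _ _ (1 + 2 * d)); first by lia.
  apply: (@reachw_sum _ 1 _ (fun q => vals`_i`_q.+1 * vals`_j`_(d.+1 - q.+1))).
    by apply: (@reachw_lin _ 0 0); apply: reach_mem; [apply: rj|apply: ri].
  move=> q qd.
  rewrite [X in (_, X)](_ : d.+1 = (q.+1 + (d.+1 - q.+1))%N); last by lia.
  apply: (@reachw_mul _ 0 0); apply: reach_mem; [apply: ri|apply: rj]; lia.
Qed.

(** Inner gates may have degree above [D], but components up to [D] depend only on components up to
    [D], and at the last gate these add up to [f]. *)
Lemma wtrace_of_circuit (c : circuit K 'I_n) (f : {mpoly K[n]}) :
  computes c f -> (msize f <= D.+1)%N ->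
  exists (L : seq (C * nat)) (outs : seq 'I_(size L)) (c0 : K),
    [/\ wtrace L, (size L <= num_gates c * (D * (2 * D + 1)))%N,
        (forall g, g \in outs -> (tr_wt g <= D)%N) &
        f = c0%:MP + \sum_(g <- outs) tr_val g].
Proof.
move=> xcoef szf; have [L [tL sL cL]] := wtrace_of_gates (circuit_wf c).
pose pm : {rmorphism K -> {poly C}} := (@polyC C) \o (@mpolyC n K).
pose theta : {rmorphism C -> {poly C}} := mmap pm penv.
have thE : theta f = circuit_eval pconst penv c.
  rewrite -xcoef; apply: circuit_eval_morph => [a|i].
    by rewrite /theta /= mmapC.
  by rewrite /theta /= mmapX mmap1U.
pose v := theta f.
have vE : v = \sum_(mu <- msupp f) (f@_mu *: 'X_[mu]) *: 'X^(mdeg mu).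
  rewrite /v /theta /mmap; apply: eq_bigr => mu _ /=.
  rewrite /mmap1 /penv; under eq_bigr => i _ do rewrite exprMn.
  rewrite big_split /= -expr_sum -mdegE -mul_polyC -mul_mpolyC polyCM -mulrA; congr (_ * _).
  rewrite mpolyXE_id rmorph_prod /=; congr (_ * _); apply: eq_bigr => i _.
  by rewrite rmorphXn.
have v1 : f = \sum_(d < D.+1) v`_d.
  rewrite {1}(mpolyE f); under [RHS]eq_bigr => d _ do rewrite vE coef_sum.
  rewrite exchange_big /= big_seq [RHS]big_seq; apply: eq_bigr => mu muf.
  have mD : (mdeg mu < D.+1)%N by apply: leq_trans szf; apply: msize_mdeg_lt.
  under [RHS]eq_bigr => d _ do rewrite coefZ coefXn.
  rewrite (bigD1 (Ordinal mD)) //= eqxx mulr1 big1 ?addr0 // => d.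
  by rewrite -val_eqE /= => /negbTE->; rewrite mulr0.
have szc : (0 < size (gates c))%N := circuit_nonempty c.
have vlast : v = (gate_values pconst penv (gates c))`_(size (gates c)).-1.
  by rewrite /v thE /circuit_eval -nth_last size_gate_values.
have [|[c0 c0E] vL] := cL (size (gates c)).-1; first by rewrite prednK.
rewrite -vlast in c0E vL.
have [outs outsP] : exists outs : seq 'I_(size L),
    (forall g, g \in outs -> (tr_wt g <= D)%N) /\
    \sum_(g <- outs) tr_val g = \sum_(d < D) v`_d.+1.
  have : forall q, (q <= D)%N -> exists outs : seq 'I_(size L),
    (forall g, g \in outs -> (tr_wt g <= D)%N) /\
    \sum_(g <- outs) tr_val g = \sum_(d < q) v`_d.+1.
    elim=> [|q IH] qD; first by exists [::]; split=> //; rewrite big_nil big_ord0.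
    have [outs [o1 o2]] := IH (ltnW qD).
    have vq := vL q.+1 qD.
    pose it : C * nat := (v`_q.+1, q.+1).
    have iL : (index it (rev L) < size L)%N by rewrite -size_rev index_mem mem_rev.
    exists (Ordinal iL :: outs); split.
      move=> g; rewrite inE => /orP[/eqP->|/o1//].
      by rewrite /tr_wt /= nth_index ?mem_rev.
    by rewrite big_cons o2 big_ord_recr /= addrC /tr_val /= nth_index ?mem_rev.
  by move/(_ D (leqnn D)).
case: outsP => o1 o2.
exists L, outs, c0; split=> //.
by rewrite o2 v1 big_ord_recl /= c0E.
Qed.
End WeightedTraceOfCircuit.

(** * Straight-line programs and coefficients of circuits *)

Section StraightLine.
Variables (K : fieldType) (m : nat).
Notation B := {mpoly K[m]}.

Inductive slp : seq B -> Prop :=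
  | slp_nil : slp [::]
  | slp_const c (L : seq B) of slp L : slp (c%:MP :: L)
  | slp_var i (L : seq B) of slp L : slp ('X_i :: L)
  | slp_add x y (L : seq B) of x \in L & y \in L & slp L : slp (x + y :: L)
  | slp_mul x y (L : seq B) of x \in L & y \in L & slp L : slp (x * y :: L).

Lemma gates_of_slp L : slp L -> exists gs : seq (gate K 'I_m),
  [/\ gates_wf 0 gs, size gs = size L &
      gate_values (fun a => a%:MP) (fun i => 'X_i) gs = rev L].
Proof.
have idx (L' : seq B) x : x \in L' -> (index x (rev L') < size L')%N.
  by move=> xL; rewrite -size_rev index_mem mem_rev.
have step L' (g : gate K 'I_m) y gs : gates_wf 0 gs -> size gs = size L' ->
    gate_values (fun a => a%:MP) (fun i => 'X_i) gs = rev L' ->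
    gate_wf (size L') g ->
    gate_eval (fun a => a%:MP) (fun i => 'X_i) (rev L') g = y ->
    exists gs : seq (gate K 'I_m), [/\ gates_wf 0 gs, size gs = size (y :: L') &
      gate_values (fun a => a%:MP) (fun i => 'X_i) gs = rev (y :: L')].
  move=> w s e wg eg; exists (rcons gs g).
  by rewrite gates_wf_rcons w s wg size_rcons s gate_values_rcons e eg rev_cons.
elim=> {L} [|c L _ [gs [w s e]]|i L _ [gs [w s e]]|x y L xL yL _ [gs [w s e]]|x y L xL yL _ [gs [w s e]]].
- by exists [::].
- exact: (step _ (GConst c) _ _ w s e).
- exact: (step _ (GVar i) _ _ w s e).
- apply: (step _ (GAdd (index x (rev L)) (index y (rev L))) _ _ w s e).
    by rewrite /= !idx.
  by rewrite /= !nth_index ?mem_rev.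
- apply: (step _ (GMul (index x (rev L)) (index y (rev L))) _ _ w s e).
    by rewrite /= !idx.
  by rewrite /= !nth_index ?mem_rev.
Qed.

Lemma slp_suffix L1 L2 : slp (L1 ++ L2) -> slp L2.
Proof.
elim: L1 => //= x L1 IH sl; apply: IH.
by inversion sl.
Qed.

(** The output of a circuit is its last gate, so the program is cut off right after [x]. *)
Lemma circuit_of_slp L x : slp L -> x \in L ->
  exists c : circuit K 'I_m, (num_gates c <= size L)%N /\ computes c x.
Proof.
move=> sl xL; case/splitPr: xL sl => L1 L2 sl.
have sl2 : slp (x :: L2) by apply: slp_suffix sl.
have [gs [w s e]] := gates_of_slp sl2.
have ne : (0 < size gs)%N by rewrite s.
exists (Circuit ne w); split; first by rewrite /num_gates /= s size_cat leq_addl.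
by rewrite /computes /circuit_eval /= e rev_cons last_rcons.
Qed.

Notation reachs := (reach slp).

Lemma reachs_add L k1 k2 x y : reachs L k1 x -> reachs L k2 y -> reachs L (k1 + k2).+1 (x + y).
Proof. by move=> r1 r2; apply: reach_step2 r1 r2 _ => L0 t0 m1 m2; apply: slp_add. Qed.

Lemma reachs_mul L k1 k2 x y : reachs L k1 x -> reachs L k2 y -> reachs L (k1 + k2).+1 (x * y).
Proof. by move=> r1 r2; apply: reach_step2 r1 r2 _ => L0 t0 m1 m2; apply: slp_mul. Qed.

Lemma reachs_const L c : reachs L 1 c%:MP.
Proof.
move=> L0 t0 s0; exists (c%:MP :: L0); split; rewrite ?mem_head //=.
- exact: slp_const.
- by move=> z zL; rewrite inE zL orbT.
- by rewrite addn1.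
Qed.

Lemma reachs_var L i : reachs L 1 'X_i.
Proof.
move=> L0 t0 s0; exists ('X_i :: L0); split; rewrite ?mem_head //=.
- exact: slp_var.
- by move=> z zL; rewrite inE zL orbT.
- by rewrite addn1.
Qed.

Lemma reachs_sum L k q (f : 'I_q -> B) :
  (forall i, reachs L k (f i)) -> reachs L (1 + q * k.+1) (\sum_(i < q) f i).
Proof.
elim: q f => [|q IH] f rf.
  by rewrite big_ord0 -(@mpolyC0 m K); apply: reachs_const.
rewrite big_ord_recr /= (_ : (1 + q.+1 * k.+1 = (1 + q * k.+1 + k).+1)%N); last by lia.
by apply: reachs_add; [apply: IH|].
Qed.

Lemma affine_mpolyE (b : B) : (msize b <= 2)%N ->
  b = (b@_0)%:MP + \sum_(i < m) (b@_U_(i))%:MP * 'X_i.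
Proof.
move=> sb; apply/mpolyP => mu; rewrite mcoeffD mcoeffC raddf_sum /=.
under eq_bigr => i _ do rewrite mcoeffCM mcoeffX.
have [mub|/memN_msupp_eq0 mub] := boolP (mu \in msupp b); last first.
  rewrite mub big1 => [|i _]; last by case: eqP => [->|_]; rewrite ?mub ?mul0r ?mulr0.
  by rewrite addr0; case: eqP => [<-|_]; rewrite ?mub ?mul0r ?mulr0.
have := leq_trans (msize_mdeg_lt mub) sb; rewrite ltnS leq_eqVlt ltnS leqn0.
case/orP=> [/mdeg1P[i /eqP muE]|]; last first.
  rewrite mdeg_eq0 => /eqP->; rewrite eqxx mulr1 big1 ?addr0 // => i _.
  by rewrite mnm1_eq0 mulr0.
rewrite muE mnm1_eq0 mulr0 add0r (bigD1 i) //= eqxx mulr1 big1 ?addr0 // => j ji.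
by rewrite eq_mnm1 (negbTE ji) mulr0.
Qed.

Lemma reachs_affine L (b : B) : (msize b <= 2)%N -> reachs L (3 + 4 * m) b.
Proof.
move=> sb; rewrite (affine_mpolyE sb).
(* One constant, a sum costing [1 + 4 * m] (three entries per summand and one per addition), and a
   last addition. *)
rewrite (_ : (3 + 4 * m = (1 + (1 + m * 3.+1)).+1)%N); last by lia.
apply: reachs_add; first exact: reachs_const.
apply: reachs_sum => i.
by apply: (@reachs_mul _ 1 1); [apply: reachs_const|apply: reachs_var].
Qed.

Section CoefficientOfCircuit.
Variables (Q X : Type) (const : Q -> B) (env : X -> {poly B}) (N : nat) (L0 : seq B).
Hypothesis const_const : forall a, exists c, const a = c%:MP.
Hypothesis env_reach : forall x d, (d <= N)%N -> reachs L0 1 (env x)`_d.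

(** Truncation at degree [N] is compatible with sums and products, so each gate needs [N.+1]
    coefficients; the longest convolution takes [2 * N + 3] entries. *)
Lemma slp_coefficients (gs : seq (gate Q X)) : slp L0 -> gates_wf 0 gs ->
  exists L, [/\ slp L, {subset L0 <= L},
    (size L <= size L0 + size gs * (N.+1 * (2 * N + 3)))%N &
    forall j d, (j < size gs)%N -> (d <= N)%N ->
      (gate_values (fun a => (const a)%:P) env gs)`_j`_d \in L].
Proof.
move=> sL0.
pose I := fun (sz : nat) (vals : seq {poly B}) =>
  exists L, [/\ slp L, {subset L0 <= L},
    (size L <= size L0 + sz * (N.+1 * (2 * N + 3)))%N &
    forall j d, (j < sz)%N -> (d <= N)%N -> vals`_j`_d \in L].
apply: (@gate_values_ind _ _ _ (fun a => (const a)%:P) env I).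
  by exists L0; split=> //; rewrite addn0.
move=> vals g [L [tL subL sL cL]] wg.
set v := gate_eval _ env vals g.
suff rv : forall d, (d <= N)%N -> reachs L (2 * N + 3) v`_d.
  pose ts := [seq v`_d | d <- iota 0 N.+1].
  have [|L1 [t1 s1 m1 z1]] := @reach_all _ _ L (2 * N + 3) ts _ L tL (fun _ h => h).
    by move=> x /mapP[d]; rewrite mem_iota add0n ltnS => dD ->; apply: rv.
  exists L1; split=> //.
  - by move=> x /subL /s1.
  - apply: leq_trans z1 _; rewrite size_map size_iota [((size vals).+1 * _)%N]mulSn addnCA.
    by rewrite [leqLHS]addnC leq_add2l.
  move=> j d; rewrite ltnS leq_eqVlt => /orP[/eqP->|js] dN.
    rewrite nth_rcons ltnn eqxx; apply: m1.
    by apply/mapP; exists d => //; rewrite mem_iota add0n ltnS.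
  by rewrite nth_rcons js; apply/s1/cL.
move=> d dN; case: g wg @v => [x|a|i j|i j] /= wg.
- apply: (@reach_leq _ _ _ 1); first by lia.
  move=> L' t' s'; apply: env_reach => // z zL; exact/s'/subL.
- apply: (@reach_leq _ _ _ 1); first by lia.
  have [c ->] := const_const a; rewrite coefC; case: eqP => _; first exact: reachs_const.
  by rewrite -(@mpolyC0 m K); apply: reachs_const.
- case/andP: wg => wi wj; apply: (@reach_leq _ _ _ 1); first by lia.
  by rewrite coefD; apply: (@reachs_add _ 0 0); apply: reach_mem; apply: cL.
- case/andP: wg => wi wj; rewrite coefM.
  apply: (@reach_leq _ _ _ (1 + d.+1 * 2)); first by lia.
  apply: (@reachs_sum L 1 d.+1) => q; have qd := ltn_ord q.
  by apply: (@reachs_mul _ 0 0); apply: reach_mem; apply: cL => //; lia.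
Qed.

Lemma slp_circuit_coefficient (c : circuit Q X) : slp L0 ->
  exists L, [/\ slp L, (size L <= size L0 + num_gates c * (N.+1 * (2 * N + 3)))%N &
    (circuit_eval (fun a => (const a)%:P) env c)`_N \in L].
Proof.
move=> sL0; have [L [sL _ zL mL]] := slp_coefficients sL0 (circuit_wf c).
have szc : (0 < size (gates c))%N := circuit_nonempty c.
exists L; split=> //; rewrite /circuit_eval -nth_last size_gate_values.
by apply: mL; rewrite ?prednK.
Qed.
End CoefficientOfCircuit.

End StraightLine.

(** * Invariants of tensors *)

Section MxvecIndex.

Lemma mxvec_index_inj m n (i i' : 'I_m) (j j' : 'I_n) :
  mxvec_index i j = mxvec_index i' j' -> i = i' /\ j = j'.
Proof. by move/cast_ord_inj/enum_rank_inj => [-> ->]. Qed.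

Lemma big_mxvec_index (R : Type) (idx : R) (op : Monoid.com_law idx) m n (F : 'I_(m * n) -> R) :
  \big[op/idx]_x F x = \big[op/idx]_(i < m) \big[op/idx]_(j < n) F (mxvec_index i j).
Proof.
rewrite (reindex _ (curry_mxvec_bij _ _)) /= pair_bigA /=.
by apply: eq_bigr => -[i j] _.
Qed.

(** [s] is a product of copies of [p], one in each block of [Q]. All copies have the sign of [p],
    and their number is even. *)
Lemma odd_block_perm d n (Q : pred 'I_d) (s : 'S_(d * n)) (p : 'S_n) :
  ~~ odd #|Q| ->
  (forall l i, s (mxvec_index l i) = mxvec_index l (if Q l then p i else i)) ->
  s = false :> bool.
Proof.
move=> evQ sE; have [ts pE _] := prod_tpermP p.
pose tprod (r : seq ('I_n * 'I_n)) : 'S_n := (\prod_(t <- r) tperm t.1 t.2)%g.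
(* The copy in block [l] of a product of transpositions, so that signs can be compared one
   transposition at a time. *)
pose slc (r : seq ('I_n * 'I_n)) (l : 'I_d) : 'S_(d * n) :=
  (\prod_(t <- r) tperm (mxvec_index l t.1) (mxvec_index l t.2))%g.
have slcE r l l' i : slc r l (mxvec_index l' i) = mxvec_index l' (if l == l' then tprod r i else i).
  rewrite /slc /tprod; elim: r i => [|t r IH] i.
    by rewrite !big_nil !perm1; case: eqP.
  rewrite !big_cons permM; case: (l =P l') IH => [<-|/eqP ll'] IH.
    rewrite !permM -IH; congr (_ _).
    case: (tpermP t.1 t.2 i) => [->|->|n1 n2]; rewrite ?tpermL ?tpermR //.
    by rewrite tpermD //; apply/eqP => /mxvec_index_inj[_ E]; [apply: n1|apply: n2].
  rewrite tpermD ?IH //; apply/eqP => /mxvec_index_inj[E _].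
    by rewrite E eqxx in ll'.
  by rewrite E eqxx in ll'.
have odd_slc r l : odd_perm (slc r l) = odd_perm (tprod r).
  rewrite /slc /tprod; elim: r => [|t r IH]; first by rewrite !big_nil !odd_perm1.
  rewrite !big_cons !odd_permM IH !odd_tperm; congr (~~ _ (+) _).
  by apply/eqP/eqP => [/mxvec_index_inj[]|->].
pose slice := slc ts.
have sliceE l l' i : slice l (mxvec_index l' i) = mxvec_index l' (if l == l' then p i else i).
  by rewrite slcE /tprod -pE.
have -> : s = (\prod_(l <- enum Q) slice l)%g.
  apply/permP => x; case/mxvec_indexP: x => l i; rewrite sE.
  have -> : Q l = (l \in enum Q) by rewrite mem_enum.
  have := enum_uniq Q; elim: (enum Q) => [|l' r IH] /=; first by rewrite big_nil perm1.
  case/andP=> l'r ur; rewrite big_cons permM sliceE inE eq_sym.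
  have [E|ll'] := eqVneq l' l; last exact: IH.
  rewrite E in l'r.
  have aux q : (\prod_(l0 <- r) slice l0)%g (mxvec_index l q) = mxvec_index l q.
    elim: r l'r {IH ur} => [|l0 r IH]; first by rewrite big_nil perm1.
    rewrite inE negb_or => /andP[ll0 lr]; rewrite big_cons permM sliceE eq_sym (negbTE ll0).
    exact: IH.
  by rewrite aux.
have -> : odd_perm (\prod_(l <- enum Q) slice l)%g = odd (size (enum Q)) && odd_perm (tprod ts).
  elim: (enum Q) => [|l r IH] /=; first by rewrite big_nil odd_perm1.
  by rewrite big_cons odd_permM IH odd_slc; case: (odd (size r)); case: (odd_perm _).
by rewrite -cardE (negbTE evQ).
Qed.
End MxvecIndex.

(** * Polynomials determined by their values *)

Section PolynomialFunctions.

Lemma digits_inj b n (f g : 'I_n -> nat) :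
  (forall i, f i < b)%N -> (forall i, g i < b)%N ->
  (\sum_(i < n) f i * b ^ i = \sum_(i < n) g i * b ^ i)%N -> f =1 g.
Proof.
elim: n f g => [|n IH] f g fb gb; first by move=> _ [].
rewrite !big_ord_recl /= !expn0 !muln1.
have E h : (\sum_(i < n) h (lift ord0 i) * b ^ bump 0 i =
            (\sum_(i < n) h (lift ord0 i) * b ^ i) * b)%N.
  by rewrite big_distrl /=; apply: eq_bigr => i _; rewrite /bump add1n expnSr mulnA.
rewrite !E => EE.
have f0 : f ord0 = g ord0.
  by have := congr1 (modn^~ b) EE; rewrite /= ![(_ + _ * b)%N]addnC !modnMDl !modn_small.
move: EE; rewrite f0 => /addnI /eqP; rewrite eqn_pmul2r; last exact: leq_ltn_trans (fb ord0).
move=> /eqP /IH H i; case: (unliftP ord0 i) => [j ->|->] //.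
by apply: H => q.
Qed.

Lemma poly_fun_eq0 (K : numFieldType) (p : {poly K}) : (forall x, p.[x] = 0) -> p = 0.
Proof.
move=> p0; apply/eqP; apply: contraT => pn0.
have := @max_poly_roots _ p [seq i%:R | i <- iota 0 (size p)] pn0.
rewrite size_map size_iota ltnn => -> //.
  by apply/allP => x _; apply/rootP.
by rewrite map_inj_uniq ?iota_uniq // => i j /eqP; rewrite eqr_nat => /eqP.
Qed.

(* Kronecker substitution [x_i := x ^ (b ^ i)] separates the monomials. *)
Lemma mpoly_fun_eq0 (K : numFieldType) n (P : {mpoly K[n]}) :
  (forall v, P.@[v] = 0) -> P = 0.
Proof.
move=> P0; pose b := (msize P).+1.
pose e (m : 'X_{1..n}) := (\sum_(i < n) m i * b ^ i)%N.
have eI m m' : m \in msupp P -> m' \in msupp P -> e m = e m' -> m = m'.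
  have lt mu i : mu \in msupp P -> (mu i < b)%N.
    move=> /msize_mdeg_lt muP; rewrite ltnS; apply: leq_trans (ltnW muP).
    by rewrite mdegE (bigD1 i) //= leq_addr.
  by move=> mP m'P /digits_inj E; apply/mnmP; apply: E => i; apply: lt.
pose q := \sum_(m <- msupp P) P@_m *: 'X^(e m) : {poly K}.
have q0 : q = 0.
  apply: poly_fun_eq0 => x; rewrite -[RHS](P0 (fun i => x ^+ (b ^ i))) mevalE /q horner_sum.
  apply: eq_bigr => m _; rewrite hornerZ hornerXn; congr (_ * _).
  by rewrite /e expr_sum; apply: eq_bigr => i _; rewrite -exprM mulnC.
apply/mpolyP => m; rewrite mcoeff0.
have [mP|/memN_msupp_eq0//] := boolP (m \in msupp P).
have := congr1 (fun r : {poly K} => r`_(e m)) q0; rewrite /= coef0 /q coef_sum.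
rewrite (bigD1_seq m) ?msupp_uniq //= big_seq_cond big1 => [|m' /andP[m'P mm']].
  by rewrite addr0 coefZ coefXn eqxx mulr1.
rewrite coefZ coefXn; case: eqP => [/eI E|_]; last by rewrite mulr0.
by rewrite E ?eqxx in mm'.
Qed.

(** Invariance is given pointwise; [mpoly_fun_eq0] lifts it to an identity of polynomials, where
    coefficients can be compared. *)
Lemma mcoeff_scale (K : numFieldType) n (P : {mpoly K[n]}) (c : 'I_n -> K) m :
  (forall v, P.@[fun i => c i * v i] = P.@[v]) ->
  P@_m * \prod_i c i ^+ m i = P@_m.
Proof.
move=> inv; pose P' := \sum_(mu <- msupp P) (P@_mu * \prod_i c i ^+ mu i) *: 'X_[mu].
have E : P' = P.
  apply/eqP; rewrite -subr_eq0; apply/eqP; apply: mpoly_fun_eq0 => v.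
  rewrite mevalB -[X in _ - X]inv [X in _ - X]mevalE /P' raddf_sum /= -sumrB big1 // => mu _.
  rewrite mevalZ mevalX -mulrA -big_split /=.
  by under [X in _ - _ * X]eq_bigr => i _ do rewrite exprMn; rewrite subrr.
have [mP|mP] := boolP (m \in msupp P); last by rewrite (memN_msupp_eq0 mP) mul0r.
rewrite -[in RHS]E /P' raddf_sum /= [RHS](bigD1_seq m) ?msupp_uniq //=.
rewrite [X in _ = _ + X]big1 ?addr0; first by rewrite mcoeffZ mcoeffX eqxx mulr1.
by move=> mu mum; rewrite mcoeffZ mcoeffX (negbTE mum) mulr0.
Qed.

Lemma mcoeff_permute (K : numFieldType) n (P : {mpoly K[n]}) (s : 'S_n) (m : 'X_{1..n}) :
  (forall v, P.@[fun i => v (s i)] = P.@[v]) -> P@_[multinom m (s i) | i < n] = P@_m.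
Proof.
move=> inv; rewrite -mcoeff_sym; congr (_@_m).
apply/eqP; rewrite -subr_eq0; apply/eqP; apply: mpoly_fun_eq0 => v.
rewrite mevalB -[X in _ - X]inv; apply/eqP; rewrite subr_eq0; apply/eqP.
rewrite /msym /mmap raddf_sum /= [RHS]mevalE; apply: eq_bigr => mu _.
rewrite mevalM mevalC; congr (_ * _); rewrite /mmap1 rmorph_prod /=.
by apply: eq_bigr => i _; rewrite rmorphXn /= mevalXU.
Qed.

End PolynomialFunctions.

Section Hyperpfaffian.
Variables (K : comNzRingType) (d n : nat).

(** The [n]-th tensor power of [T] contracted with the determinant of [d * n] vectors; for [d = 2]
    it is a multiple of the Pfaffian of the antisymmetrised [T]. The ring [A] allows both numerical
    and generic tensors. *)
Definition hyperpfaffian (A : pzRingType) (T : multi_index d (d * n) -> A) : A :=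
  \sum_(s : 'S_(d * n)) (-1) ^+ s * \prod_(i < n) T [ffun l => s (mxvec_index l i)].

Lemma tensor_act1 N (T : tensor K d N) : tensor_act 1%:M T = T.
Proof.
apply/ffunP => i; rewrite ffunE (bigD1 i) //= [X in _ + X]big1 ?addr0.
  by rewrite big1 ?mul1r // => l _; rewrite mxE eqxx.
move=> j ji; have /existsP[l hl] : [exists l, i l != j l].
  by apply: contraNT ji => /existsPn H; apply/eqP/ffunP => l; apply/esym/eqP/negbNE/H.
by rewrite (bigD1 l) //= mxE (negbTE hl) mul0r mul0r.
Qed.

(** After expansion, the sum over [s] is the determinant of [g] with columns selected by [F], that
    is [\det (P F) * \det g]. The case [g = 1] identifies what multiplies [\det g]. *)
Lemma hyperpfaffian_act (g : 'M[K]_(d * n)) (T : tensor K d (d * n)) :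
  hyperpfaffian (tensor_act g T) = \det g * hyperpfaffian T.
Proof.
pose h (F : {ffun 'I_n -> multi_index d (d * n)}) (x : 'I_(d * n)) : 'I_(d * n) :=
  mxvec (\matrix_(l, i) F i l) 0 x.
have hE F l i : h F (mxvec_index l i) = F i l by rewrite /h mxvecE mxE.
pose P F : 'M[K]_(d * n) := \matrix_(x, z) (z == h F x)%:R.
have key (g' : 'M[K]_(d * n)) : hyperpfaffian (tensor_act g' T) =
    \sum_(F : {ffun 'I_n -> multi_index d (d * n)}) (\prod_i T (F i)) * (\det (P F) * \det g').
  transitivity (\sum_(s : 'S_(d * n)) \sum_(F : {ffun 'I_n -> multi_index d (d * n)})
      (\prod_i T (F i)) * ((-1) ^+ s * \prod_x g' (s x) (h F x))).
    apply: eq_bigr => s _.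
    under eq_bigr => i _ do rewrite ffunE.
    rewrite bigA_distr_bigA /= mulr_sumr; apply: eq_bigr => F _.
    rewrite mulrCA big_split /=; congr (_ * _); rewrite mulrC.
    congr (_ * _); rewrite big_mxvec_index exchange_big /=.
    by apply: eq_bigr => i _; apply: eq_bigr => l _; rewrite ffunE hE.
  rewrite exchange_big /=; apply: eq_bigr => F _; rewrite -mulr_sumr; congr (_ * _).
  rewrite -[\det g']det_tr -det_mulmx /determinant; apply: eq_bigr => s _; congr (_ * _).
  apply: eq_bigr => x _; rewrite mxE (bigD1 (h F x)) //= !mxE eqxx mul1r big1 ?addr0 //.
  by move=> z zx; rewrite !mxE (negbTE zx) mul0r.
rewrite key -[in RHS](tensor_act1 T) key det1 mulr_sumr; apply: eq_bigr => F _.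
by rewrite mulr1 mulrA mulrC mulrA.
Qed.
End Hyperpfaffian.

Section TensorActions.
Variables (K : comNzRingType) (d N : nat).

Lemma tensor_act_diag (t : 'rV[K]_N) (T : tensor K d N) i :
  tensor_act (diag_mx t) T i = (\prod_l t 0 (i l)) * T i.
Proof.
rewrite ffunE (bigD1 i) //= [X in _ + X]big1 ?addr0.
  by congr (_ * _); apply: eq_bigr => l _; rewrite mxE eqxx mulr1n.
move=> j ji; have /existsP[l hl] : [exists l, i l != j l].
  by apply: contraNT ji => /existsPn H; apply/eqP/ffunP => l; apply/esym/eqP/negbNE/H.
by rewrite (bigD1 l) //= mxE (negbTE hl) mulr0n !mul0r.
Qed.

Lemma tensor_act_perm (s : 'S_N) (T : tensor K d N) i :
  tensor_act (perm_mx s) T i = T [ffun l => s (i l)].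
Proof.
rewrite ffunE (bigD1 [ffun l => s (i l)]) //= [X in _ + X]big1 ?addr0.
  by rewrite big1 ?mul1r // => l _; rewrite mxE mxE ffunE eqxx.
move=> j ji; have /existsP[l hl] : [exists l, s (i l) != j l].
  by apply: contraNT ji => /existsPn H; apply/eqP/ffunP => l; rewrite ffunE; apply/esym/eqP/negbNE/H.
by rewrite (bigD1 l) //= !mxE (negbTE hl) !mul0r.
Qed.
End TensorActions.

Lemma block_perm_exists m n (F : 'I_m -> 'S_n) : exists s : 'S_(m * n),
  forall l i, s (mxvec_index l i) = mxvec_index l (F l i).
Proof.
pose f x := mxvec (\matrix_(l < m, i < n) mxvec_index l (F l i)) 0 x.
have fE l i : f (mxvec_index l i) = mxvec_index l (F l i) by rewrite /f mxvecE mxE.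
have fI : injective f.
  move=> x y; case/mxvec_indexP: x => l i; case/mxvec_indexP: y => l' i'.
  by rewrite !fE => /mxvec_index_inj[<- /perm_inj->].
by exists (perm fI) => l i; rewrite permE fE.
Qed.

(** * Restricting invariants to tensors built from a matrix *)

Section MatrixTensors.
Variables (k n : nat).
Hypothesis k_gt0 : (0 < k)%N.
Notation d := (2 * k)%N.
Notation N := (2 * k * n)%N.

(* The basis vectors of [K^(2kn)] are indexed by pairs [(l, i)] through
   [mxvec_index l i]; [mx_index i j] is the multi-index of
   [e_(0,i) (x) ... (x) e_(k-1,i) (x) e_(k,j) (x) ... (x) e_(2k-1,j)]. *)
Definition mx_index (i j : 'I_n) : multi_index d N :=
  [ffun l : 'I_d => mxvec_index l (if (l < k)%N then i else j)].

Definition mx_tensor (A : nmodType) (X : 'I_n -> 'I_n -> A) (tau : multi_index d N) : A :=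
  if [pick ij | mx_index ij.1 ij.2 == tau] is Some ij then X ij.1 ij.2 else 0.

Definition low_idx : 'I_d := Ordinal (leq_trans k_gt0 (leq_pmull k (ltn0Sn 1)) : (0 < d)%N).
Lemma high_idx_proof : (k < d)%N. Proof. by lia. Qed.
Definition high_idx : 'I_d := Ordinal high_idx_proof.

Lemma mx_index_inj i j i' j' : mx_index i j = mx_index i' j' -> i = i' /\ j = j'.
Proof.
move/ffunP=> E; have := E low_idx; have := E high_idx; rewrite !ffunE /= ltnn k_gt0.
by move=> /mxvec_index_inj[_ ->] /mxvec_index_inj[_ ->].
Qed.

Lemma mx_tensorE (A : nmodType) (X : 'I_n -> 'I_n -> A) i j : mx_tensor X (mx_index i j) = X i j.
Proof.
rewrite /mx_tensor; case: pickP => [[i' j'] /eqP /mx_index_inj[-> ->] //|/(_ (i, j))].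
by rewrite /= eqxx.
Qed.

Lemma mx_tensor0 (A : nmodType) (X : 'I_n -> 'I_n -> A) tau :
  (forall i j, tau <> mx_index i j) -> mx_tensor X tau = 0.
Proof. by move=> out; rewrite /mx_tensor; case: pickP => // -[i j] /eqP /esym /out. Qed.

Lemma mx_tensor_cases (tau : multi_index d N) :
  (exists i j, tau = mx_index i j) \/ (forall i j, tau <> mx_index i j).
Proof.
have [/existsP[i /existsP[j /eqP E]]|h] := boolP [exists i, exists j, tau == mx_index i j].
  by left; exists i, j.
by right=> i j E; case/existsP: h; exists i; apply/existsP; exists j; rewrite E.
Qed.

Lemma mx_tensor_raddf (A A' : nmodType) (f : A -> A') (X : 'I_n -> 'I_n -> A) tau :
  f 0 = 0 -> f (mx_tensor X tau) = mx_tensor (fun i j => f (X i j)) tau.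
Proof.
move=> f0; have [[i [j ->]]|out] := mx_tensor_cases tau; first by rewrite !mx_tensorE.
by rewrite !mx_tensor0.
Qed.

Lemma eq_mx_tensor (A : nmodType) (X Y : 'I_n -> 'I_n -> A) tau :
  X =2 Y -> mx_tensor X tau = mx_tensor Y tau.
Proof.
move=> XY; have [[i [j ->]]|out] := mx_tensor_cases tau; first by rewrite !mx_tensorE.
by rewrite !mx_tensor0.
Qed.

Variable K : numFieldType.
Hypothesis k_even : ~~ odd k.
Hypothesis n_gt0 : (0 < n)%N.

Definition mx_vars : (tensor_dim d N).-tuple {mpoly K[n * n]} :=
  [tuple mx_tensor (fun i j => 'X_(mxvec_index i j)) (enum_val q) | q < tensor_dim d N].

Definition restrict (f : {mpoly K[tensor_dim d N]}) : {mpoly K[n * n]} := f \mPo mx_vars.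

Lemma meval_restrict f (v : 'I_(n * n) -> K) : (restrict f).@[v] =
  f.@[tensor_coord [ffun tau => mx_tensor (fun i j => v (mxvec_index i j)) tau]].
Proof.
rewrite /restrict comp_mpoly_meval; apply: meval_eq => q; rewrite tnth_mktuple /tensor_coord ffunE.
rewrite (@mx_tensor_raddf _ _ (meval v)) ?meval0 //; apply: eq_mx_tensor => i j.
by rewrite mevalXU.
Qed.

Section Invariant.
Variable f : {mpoly K[tensor_dim d N]}.
Hypothesis f_inv : SL_invariant f.

(** The effect on matrix entries of the diagonal element that doubles [e_(0,i0)] and halves
    [e_(k,j0)], which has determinant 1. *)
Definition torus_weight (i0 j0 : 'I_n) (z : 'I_(n * n)) : K :=
  mxvec (\matrix_(i < n, j < n) ((if i == i0 then 2%:R else 1) * (if j == j0 then 2%:R^-1 else 1))) 0 z.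

Lemma restrict_torus i0 j0 v :
  (restrict f).@[fun z => torus_weight i0 j0 z * v z] = (restrict f).@[v].
Proof.
pose tau1 (l : 'I_d) (i : 'I_n) : K := if (l == low_idx) && (i == i0) then 2%:R else 1.
pose tau2 (l : 'I_d) (i : 'I_n) : K := if (l == high_idx) && (i == j0) then 2%:R^-1 else 1.
pose t : 'rV[K]_N := mxvec (\matrix_(l < d, i < n) (tau1 l i * tau2 l i)).
have tE l i : t 0 (mxvec_index l i) = tau1 l i * tau2 l i by rewrite mxvecE mxE.
have one (l0 : 'I_d) i1 c : \prod_(l < d) \prod_(i < n)
    (if (l == l0) && (i == i1) then c else 1 : K) = c.
  rewrite (bigD1 l0) //= (bigD1 i1) //= !eqxx /= big1 ?mulr1 => [|i /negbTE->//].
  by rewrite big1 ?mulr1 // => l /negbTE ll; rewrite big1 // => i _; rewrite ll.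
have dt : \det (diag_mx t) = 1.
  rewrite det_diag big_mxvec_index.
  under eq_bigr => l _ do under eq_bigr => i _ do rewrite tE.
  under eq_bigr => l _ do rewrite big_split /=.
  by rewrite big_split /= !one mulfV // pnatr_eq0.
rewrite !meval_restrict -[RHS](f_inv dt); apply: meval_eq => q; rewrite /tensor_coord.
rewrite tensor_act_diag !ffunE; have [[i [j ->]]|out] := mx_tensor_cases (enum_val q); last first.
  by rewrite !mx_tensor0 // mulr0.
rewrite !mx_tensorE; congr (_ * _).
rewrite /torus_weight mxvecE mxE; under [RHS]eq_bigr => l _ do rewrite ffunE tE.
rewrite big_split /=; congr (_ * _).
  rewrite (bigD1 low_idx) //= /tau1 k_gt0 eqxx /= big1 ?mulr1 // => l /negbTE->.
  by [].
rewrite (bigD1 high_idx) //= /tau2 ltnn eqxx /= big1 ?mulr1 // => l /negbTE->.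
by [].
Qed.

(** The torus element scales the monomial by 2 to the power row sum minus column sum; 2 is not a
    root of unity, so the sums agree. *)
Lemma restrict_row_col (m : 'X_{1..n * n}) i0 j0 : (restrict f)@_m != 0 ->
  (\sum_j m (mxvec_index i0 j) = \sum_i m (mxvec_index i j0))%N.
Proof.
move=> m0; have := mcoeff_scale m (restrict_torus i0 j0).
rewrite -[RHS]mulr1 => /(mulfI m0).
rewrite big_mxvec_index /=.
under eq_bigr => i _ do under eq_bigr => j _ do rewrite /torus_weight mxvecE mxE exprMn.
under eq_bigr => i _ do rewrite big_split /=.
have E1 : \prod_i \prod_j (if i == i0 then 2%:R else 1 : K) ^+ m (mxvec_index i j) =
    2%:R ^+ (\sum_j m (mxvec_index i0 j))%N.
  rewrite (bigD1 i0) //= [X in _ * X]big1 ?mulr1; first by rewrite eqxx expr_sum.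
  by move=> i /negbTE->; rewrite big1 // => j _; rewrite expr1n.
have E2 : \prod_(i < n) \prod_j (if j == j0 then 2%:R^-1 else 1 : K) ^+ m (mxvec_index i j) =
    2%:R^-1 ^+ (\sum_i m (mxvec_index i j0))%N.
  rewrite exchange_big (bigD1 j0) //= [X in _ * X]big1 ?mulr1; first by rewrite eqxx expr_sum.
  by move=> j /negbTE->; rewrite big1 // => i _; rewrite expr1n.
rewrite big_split /= E1 E2 exprVn => /divr1_eq /eqP.
rewrite -!natrX eqr_nat eqn_exp2l // => /eqP //.
Qed.

(** Applying [p] in the blocks [l >= k] permutes the columns of the matrix. There are [k] such
    blocks, an even number, so the permutation matrix has determinant 1. *)
Lemma restrict_permute (p : 'S_n) : exists S : 'S_(n * n),
  (forall i j, S (mxvec_index i j) = mxvec_index i (p j)) /\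
  (forall v, (restrict f).@[fun z => v (S z)] = (restrict f).@[v]).
Proof.
have [S SE] := block_perm_exists (fun _ : 'I_n => p).
exists S; split=> // v.
have [s sE] := block_perm_exists (fun l : 'I_d => if (k <= l)%N then p else 1%g).
have s_even : s = false :> bool.
  apply: (@odd_block_perm d n [pred l : 'I_d | (k <= l)%N] s p); last first.
    by move=> l i; rewrite sE /=; case: leqP => //; rewrite perm1.
  have -> : #|[pred l : 'I_d | (k <= l)%N]| = k; last by [].
  rewrite -sum1_card (eq_bigl (fun l : 'I_d => (k <= l)%N)) //.
  rewrite -(big_mkord (fun l => (k <= l)%N) (fun=> 1%N)) (big_cat_nat (n := k)) //=; last by lia.
  rewrite big_nat_cond big_pred0 => [|l]; last by lia.
  rewrite big_nat_cond (eq_bigl (fun l => (k <= l < d)%N)) => [|l]; last by lia.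
  by rewrite -big_nat sum_nat_const_nat; lia.
have ds : \det (perm_mx s : 'M[K]_N) = 1 by rewrite det_perm s_even.
rewrite !meval_restrict -[RHS](f_inv ds); apply: meval_eq => q; rewrite /tensor_coord.
rewrite tensor_act_perm !ffunE.
have sJ i j : [ffun l => s (mx_index i j l)] = mx_index i (p j).
  apply/ffunP => l; rewrite !ffunE sE.
  by case: (ltnP l k); rewrite ?perm1.
have [[i [j ->]]|out] := mx_tensor_cases (enum_val q).
  by rewrite sJ !mx_tensorE SE.
rewrite !mx_tensor0 // => i j E; apply: (out i ((p^-1)%g j)).
apply/ffunP => l; apply: (@perm_inj _ s).
have := sJ i ((p^-1)%g j); rewrite permKV -E => /ffunP/(_ l); rewrite !ffunE => <-.
by [].
Qed.

Definition perm_mon (p : 'S_n) : 'X_{1..n * n} :=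
  [multinom mxvec (\matrix_(i < n, j < n) (p i == j : nat)) 0%R z | z < n * n].

Lemma perm_monE p i j : perm_mon p (mxvec_index i j) = (p i == j).
Proof. by rewrite mnmE mxvecE mxE. Qed.

Lemma perm_mon_inj : injective perm_mon.
Proof.
move=> p q E; apply/permP => i; have := perm_monE p i (p i); rewrite E perm_monE eqxx.
by case: eqP.
Qed.

Lemma mdeg_mxvec (m : 'X_{1..n * n}) : mdeg m = (\sum_i \sum_j m (mxvec_index i j))%N.
Proof. by rewrite mdegE big_mxvec_index. Qed.

Lemma mdeg_perm_mon p : mdeg (perm_mon p) = n.
Proof.
rewrite mdeg_mxvec (eq_bigr (fun=> 1%N)) ?sum_nat_const ?card_ord ?muln1 // => i _.
rewrite (bigD1 (p i)) //= perm_monE eqxx big1 // => j /negbTE pj.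
by rewrite perm_monE eq_sym pj.
Qed.

(** Every row sum equals every column sum, so all have a common value [r] and the degree is [n * r].
    Thus [r] is 0 or 1, and [r = 1] describes a permutation matrix. *)
Lemma restrict_mon (m : 'X_{1..n * n}) : (restrict f)@_m != 0 -> (mdeg m <= n)%N ->
  m = 0%MM \/ exists p, m = perm_mon p.
Proof.
move=> m0 mn; have rc := fun i j => @restrict_row_col m i j m0.
pose i0 : 'I_n := Ordinal n_gt0.
pose r := (\sum_j m (mxvec_index i0 j))%N.
have col j : (\sum_i m (mxvec_index i j) = r)%N by rewrite -(rc i0 j).
have row i : (\sum_j m (mxvec_index i j) = r)%N by rewrite (rc i i0) col.
have mE : mdeg m = (n * r)%N.
  by rewrite mdeg_mxvec (eq_bigr (fun=> r)) // sum_nat_const card_ord.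
have [r0|r1] : r = 0%N \/ r = 1%N by move: mn; rewrite mE; case: (r) => [|[|q]]; nia.
  by left; apply/eqP; rewrite -mdeg_eq0 mE r0 muln0.
right.
have [p pP] : exists p : 'I_n -> 'I_n, forall i, (0 < m (mxvec_index i (p i)))%N.
  apply: (@fin_all_exists 'I_n (fun=> 'I_n) (fun i j => (0 < m (mxvec_index i j))%N)) => i.
  have /eqP := row i; rewrite r1.
  have [/existsP[j hj] _|/existsPn h] := boolP [exists j, (0 < m (mxvec_index i j))%N].
    by exists j.
  by rewrite big1 // => j _; apply/eqP; rewrite -leqn0 leqNgt h.
have rest i j : j != p i -> m (mxvec_index i j) = 0%N.
  move=> jp; have := row i; rewrite r1 (bigD1 (p i)) //= (bigD1 j) //=.
  by have := pP i; lia.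
have pI : injective p.
  move=> i i' E; apply: contraTeq isT => ii'; have := col (p i).
  rewrite r1 (bigD1 i) //= (bigD1 i') 1?eq_sym //= {2}E.
  by have := pP i; have := pP i'; lia.
exists (perm pI); apply/mnmP => z; case/mxvec_indexP: z => i j; rewrite perm_monE permE.
have [<-|pj] := eqVneq (p i) j; last by rewrite rest // eq_sym.
by have := pP i; have := row i; rewrite r1 (bigD1 (p i)) //=; lia.
Qed.

(** Column permutations act transitively on the permutation monomials. *)
Lemma restrict_coef_perm p : (restrict f)@_(perm_mon p) = (restrict f)@_(perm_mon 1).
Proof.
have [S [SE Sinv]] := restrict_permute p.
rewrite -(mcoeff_permute (perm_mon p) Sinv); congr (_@_ _).
apply/mnmP => z; case/mxvec_indexP: z => i j.
by rewrite mnmE SE !perm_monE perm1 (inj_eq perm_inj).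
Qed.

End Invariant.

End MatrixTensors.

Lemma dhomog_prod1 (R : comNzRingType) q n (F : 'I_n -> {mpoly R[q]}) :
  (forall i, F i \is 1.-homog) -> \prod_(i < n) F i \is n.-homog.
Proof.
elim: n F => [|n IH] F h; first by rewrite big_ord0 dhomog1.
rewrite big_ord_recl; apply: (@dhomogM _ _ _ 1 _ n); first exact: h.
by apply: IH.
Qed.

(** * The degree [n] part of an invariant *)

Section LowDegreeInvariants.
Variables (k n : nat) (K : numFieldType).
Hypothesis k_gt0 : (0 < k)%N.
Hypothesis k_even : ~~ odd k.
Hypothesis n_gt0 : (0 < n)%N.
Notation d := (2 * k)%N.
Notation N := (2 * k * n)%N.
Notation restr := (@restrict k n K).

Definition hyperpfaffian_poly : {mpoly K[tensor_dim d N]} :=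
  @hyperpfaffian d n {mpoly K[tensor_dim d N]} (fun tau => 'X_(enum_rank tau)).

Lemma hyperpfaffian_rmorph (A A' : nzRingType) (g : {rmorphism A -> A'}) (T : multi_index d N -> A) :
  g (@hyperpfaffian d n A T) = @hyperpfaffian d n A' (fun tau => g (T tau)).
Proof.
rewrite /hyperpfaffian rmorph_sum; apply: eq_bigr => s _.
by rewrite rmorphM rmorphXn rmorphN1 rmorph_prod.
Qed.

Lemma eq_hyperpfaffian (A : nzRingType) (T T' : multi_index d N -> A) :
  T =1 T' -> @hyperpfaffian d n A T = @hyperpfaffian d n A T'.
Proof.
by move=> TT'; apply: eq_bigr => s _; congr (_ * _); apply: eq_bigr => i _; apply: TT'.
Qed.

Lemma hyperpfaffian_poly_eval (T : tensor K d N) :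
  hyperpfaffian_poly.@[tensor_coord T] = hyperpfaffian T.
Proof.
rewrite hyperpfaffian_rmorph; apply: eq_hyperpfaffian => tau.
by rewrite /= mevalXU /tensor_coord enum_rankK.
Qed.

Lemma hyperpfaffian_poly_inv : SL_invariant hyperpfaffian_poly.
Proof.
by move=> g dg T; rewrite !hyperpfaffian_poly_eval hyperpfaffian_act dg mul1r.
Qed.

Lemma restrict_hyperpfaffian_homog : restr hyperpfaffian_poly \is n.-homog.
Proof.
rewrite /restrict hyperpfaffian_rmorph.
apply: rpred_sum => s _; rewrite mulr_sign.
have h : \prod_(i < n) ('X_(enum_rank [ffun l => s (mxvec_index l i)]) \mPo mx_vars k n K)
    \is n.-homog.
  apply: dhomog_prod1 => i; rewrite comp_mpolyXU -tnth_nth tnth_mktuple enum_rankK.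
  have [[i' [j ->]]|out] := mx_tensor_cases [ffun l => s (mxvec_index l i)]; last first.
    by rewrite mx_tensor0 // dhomog0.
  by rewrite (mx_tensorE k_gt0) dhomogX /= mdeg1.
by case: (odd_perm s) => //; rewrite rpredN.
Qed.

(** A term is nonzero only if [s] acts by one permutation in all [2k] blocks, and then its sign is
    [+]. So nothing cancels, and the identity contributes 1. *)
Lemma hyperpfaffian_diag_neq0 :
  @hyperpfaffian d n K (fun tau => mx_tensor (fun i j => (i == j)%:R) tau) != 0.
Proof.
set T := (fun tau : multi_index d N => _).
have T01 tau : T tau = 0 \/ (T tau = 1 /\ exists i, tau = mx_index k i i).
  rewrite /T; have [[i [j ->]]|out] := mx_tensor_cases tau; last by left; rewrite mx_tensor0.
  rewrite (mx_tensorE k_gt0); case: (eqVneq i j) => [<-|ij]; [right|by left].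
  by split=> //; exists i.
have term (s : 'S_N) : 0 <= (-1) ^+ s * \prod_(i < n) T [ffun l => s (mxvec_index l i)].
  have [/existsP[i /eqP Ti]|/existsPn nz] :=
    boolP [exists i : 'I_n, T [ffun l => s (mxvec_index l i)] == 0].
    by rewrite (bigD1 i) //= Ti mul0r mulr0.
  have [p pP] : exists p : 'I_n -> 'I_n, forall i,
      [ffun l => s (mxvec_index l i)] = mx_index k (p i) (p i) /\
      T [ffun l => s (mxvec_index l i)] = 1.
    apply: (@fin_all_exists 'I_n (fun=> 'I_n) (fun i q =>
      [ffun l => s (mxvec_index l i)] = mx_index k q q /\
      T [ffun l => s (mxvec_index l i)] = 1)) => i.
    have [T0|[T1 [q E]]] := T01 [ffun l => s (mxvec_index l i)].
      by have := nz i; rewrite T0 eqxx.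
    by exists q.
  have sE l i : s (mxvec_index l i) = mxvec_index l (p i).
    by have [/ffunP/(_ l)] := pP i; rewrite !ffunE if_same => ->.
  have pI : injective p.
    move=> i i' E; have := sE (low_idx k_gt0) i; rewrite E -sE => /perm_inj.
    by case/mxvec_index_inj.
  have -> : s = false :> bool.
    apply: (@odd_block_perm d n predT s (perm pI)).
      by rewrite card_ord mul2n odd_double.
    by move=> l i; rewrite sE permE.
  by rewrite mul1r prodr_ge0 // => i _; have [_ ->] := pP i.
rewrite /hyperpfaffian (bigD1 1%g) //= gt_eqF // ltr_wpDr ?sumr_ge0 //.
rewrite odd_perm1 mul1r big1 // => i _; rewrite /T.
have -> : [ffun l => (1%g : 'S_N) (mxvec_index l i)] = mx_index k i i.
  by apply/ffunP => l; rewrite !ffunE perm1 if_same.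
by rewrite (mx_tensorE k_gt0) eqxx.
Qed.
(** Constant terms are allowed, which makes this condition stable under the operations of a
    subalgebra. *)
Definition no_low_terms (F : {mpoly K[n * n]}) : Prop :=
  forall m, (0 < mdeg m <= n)%N -> F@_m = 0.

(** If a product of monomials has degree at most [n], so do both factors; they are then constant,
    and so is the product. *)
Lemma no_low_termsM F G : no_low_terms F -> no_low_terms G -> no_low_terms (F * G).
Proof.
move=> hF hG m mn; apply/eqP; rewrite mcoeff_eq0; apply/negP => /msuppM_le.
case/allpairsP => -[m1 m2] /= [h1 h2 mE].
have aux H mu : no_low_terms H -> mu \in msupp H -> (mdeg mu <= n)%N -> mdeg mu = 0%N.
  move=> hH muH mun; case: (posnP (mdeg mu)) => // mu0.
  by move: muH; rewrite mcoeff_msupp hH ?eqxx // mu0.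
have := mn; rewrite mE mdegD.
have [le1 le2] : (mdeg m1 <= n)%N /\ (mdeg m2 <= n)%N.
  by have := mn; rewrite mE mdegD; lia.
by rewrite (aux _ _ hF h1 le1) (aux _ _ hG h2 le2).
Qed.

Lemma no_low_terms_subalg (S : {mpoly K[tensor_dim d N]} -> Prop) f :
  (forall g, S g -> no_low_terms (restr g)) -> gen_subalg S f -> no_low_terms (restr f).
Proof.
move=> hS; elim=> {f} [f /hS //|a|f g _ hf _ hg|f g _ hf _ hg].
- move=> m /andP[m0 _]; rewrite /restrict comp_mpolyC mcoeffC.
  by rewrite -mdeg_eq0 gtn_eqF // mulr0.
- by move=> m mn; rewrite /restrict raddfD /= mcoeffD hf // hg // addr0.
- by rewrite /restrict rmorphM; apply: no_low_termsM.
Qed.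

(* If no generator had a degree-[n] term on the matrix tensors, no invariant
   would, but the hyperpfaffian does. *)
Lemma exists_generator_with_perm_term (S : {mpoly K[tensor_dim d N]} -> Prop) :
  (forall f, gen_subalg S f <-> @SL_invariant K d N f) ->
  exists2 f, S f & (restr f)@_(perm_mon 1) != 0.
Proof.
move=> gen; apply: boolp.contrapT => none.
have hS g : S g -> no_low_terms (restr g).
  move=> Sg; have ginv : @SL_invariant K d N g by apply/gen/gen_incl.
  move=> m /andP[m0 mn]; apply/eqP/negPn/negP => nz.
  have [mE|[p mE]] := restrict_mon k_gt0 k_even n_gt0 ginv nz mn.
    by move: m0; rewrite mE mdeg0.
  by apply: none; exists g => //; rewrite -(restrict_coef_perm k_gt0 k_even n_gt0 ginv p) -mE.
have hp : no_low_terms (restr hyperpfaffian_poly).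
  by apply: no_low_terms_subalg hS _; apply/gen; apply: hyperpfaffian_poly_inv.
have : restr hyperpfaffian_poly = 0.
  apply/mpolyP => m; rewrite mcoeff0; have [mn|mn] := eqVneq (mdeg m) n.
    by apply: hp; rewrite mn n_gt0 leqnn.
  exact: dhomog_nemf_coeff restrict_hyperpfaffian_homog mn.
pose v (z : 'I_(n * n)) : K := mxvec (\matrix_(i < n, j < n) (i == j)%:R) 0 z.
move=> /(congr1 (meval v)); rewrite meval0 (meval_restrict k_gt0) hyperpfaffian_poly_eval.
rewrite (@eq_hyperpfaffian _ _ (fun tau => mx_tensor (fun i j => (i == j)%:R) tau)).
  by apply/eqP; apply: hyperpfaffian_diag_neq0.
move=> tau; rewrite ffunE; apply: eq_mx_tensor => // i j.
by rewrite /v mxvecE mxE.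
Qed.

Section CoefficientIsPermanent.
Variables (q : nat) (X : 'I_n -> 'I_n -> {mpoly K[q]}).
Notation B := {mpoly K[q]}.

Let pm : {rmorphism K -> {poly B}} := (@polyC B) \o (@mpolyC q K).
Let Xv (z : 'I_(n * n)) : B := mxvec (\matrix_(i < n, j < n) X i j) 0 z.
Let theta : {rmorphism {mpoly K[n * n]} -> {poly B}} := mmap pm (fun z => (Xv z)%:P * 'X).

Definition graded_env (tau : multi_index d N) : {poly B} := (mx_tensor X tau)%:P * 'X.

Lemma theta_X (m : 'X_{1..n * n}) :
  theta 'X_[m] = (\prod_z Xv z ^+ m z)%:P * 'X^(mdeg m).
Proof.
rewrite /theta /= mmapX /mmap1 /=; under [LHS]eq_bigr => z _ do rewrite exprMn.
rewrite big_split /= -expr_sum -mdegE rmorph_prod; congr (_ * _).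
by apply: eq_bigr => z _; rewrite rmorphXn.
Qed.

Lemma theta_coef_eq0 (F : {mpoly K[n * n]}) :
  (forall m, mdeg m = n -> F@_m = 0) -> (theta F)`_n = 0.
Proof.
move=> F0; rewrite (mpolyE F) raddf_sum /= coef_sum big1 // => m _.
rewrite -mul_mpolyC.
have -> : theta ((F@_m)%:MP * 'X_[m]) = (F@_m)%:MP%:P * theta 'X_[m].
  by rewrite rmorphM; congr (_ * _); rewrite /theta /= mmapC.
rewrite theta_X mulrA -polyCM coefCM coefXn.
by case: eqP => [/esym/F0->|_]; rewrite ?mpolyC0 ?mul0r ?mulr0.
Qed.

(** The grading variable counts the degree in the matrix entries, not in the variables inside [X].
    In degree [n] only permutation monomials occur, all with the same coefficient. *)
Lemma graded_coefficient (f : {mpoly K[tensor_dim d N]}) : @SL_invariant K d N f ->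
  (mmap pm (fun z => graded_env (enum_val z)) f)`_n =
  ((restr f)@_(perm_mon 1))%:MP * permanent X.
Proof.
move=> finv; set kappa := (restr f)@_(perm_mon 1).
have -> : mmap pm (fun z => graded_env (enum_val z)) f = theta (restr f).
  rewrite /restrict /comp_mpoly [in RHS]/mmap raddf_sum /=; apply: eq_bigr => m _.
  rewrite rmorphM; congr (_ * _); first by rewrite /theta /= mmapC.
  rewrite /mmap1 rmorph_prod; apply: eq_bigr => z _; rewrite rmorphXn; congr (_ ^+ _).
  rewrite tnth_mktuple /graded_env; have [[i [j ->]]|out] := mx_tensor_cases (enum_val z).
    by rewrite !(mx_tensorE k_gt0) /theta /= mmapX mmap1U /Xv mxvecE mxE.
  by rewrite !mx_tensor0 // polyC0 mul0r rmorph0.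
(* The generic permanent; [G] is what remains of the restriction, and it has no term of degree
   [n]. *)
pose permP : {mpoly K[n * n]} := \sum_(p : 'S_n) 'X_[perm_mon p].
have coefP m : permP@_m = \sum_(p : 'S_n) (perm_mon p == m)%:R.
  by rewrite /permP raddf_sum /=; apply: eq_bigr => p _; rewrite mcoeffX.
pose G := restr f - kappa *: permP.
have fE : restr f = G + kappa%:MP * permP by rewrite mul_mpolyC /G subrK.
have thD : theta (restr f) = theta G + kappa%:MP%:P * theta permP.
  rewrite fE (rmorphD theta) (rmorphM theta); congr (_ + _ * _).
  by rewrite /theta /= mmapC.
have thP : theta permP = \sum_(p : 'S_n) theta 'X_[perm_mon p] by exact: (rmorph_sum theta).
suff G0 : (theta G)`_n = 0.
  rewrite thD coefD [X in X + _]G0 add0r coefCM thP coef_sum; congr (_ * _).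
  apply: eq_bigr => p _; rewrite theta_X coefCM coefXn mdeg_perm_mon eqxx mulr1.
  rewrite big_mxvec_index; apply: eq_bigr => i _; rewrite (bigD1 (p i)) //= big1 ?mulr1.
    by rewrite perm_monE eqxx expr1 /Xv mxvecE mxE.
  by move=> j pj; rewrite perm_monE eq_sym (negbTE pj) expr0.
apply: theta_coef_eq0 => m mn; rewrite /G mcoeffB mcoeffZ coefP.
have [[p ->]|out] : (exists p, m = perm_mon p) \/ (forall p, perm_mon p != m).
  have [/existsP[p /eqP E]|/existsPn out] := boolP [exists p, perm_mon p == m]; last by right.
  by left; exists p.
  rewrite (bigD1 p) //= eqxx big1 ?addr0 ?mulr1.
    by rewrite (restrict_coef_perm k_gt0 k_even n_gt0 finv p) subrr.
  by move=> p' pp'; rewrite (inj_eq (@perm_mon_inj n)) (negbTE pp').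
rewrite big1 ?mulr0 ?subr0; last by move=> p _; rewrite (negbTE (out p)).
apply/eqP/negPn/negP => nz.
have [|mE|[p mE]] := restrict_mon k_gt0 k_even n_gt0 finv nz; first by rewrite mn.
  by move: n_gt0; rewrite -mn mE mdeg0.
by have := out p; rewrite mE eqxx.
Qed.

End CoefficientIsPermanent.
End LowDegreeInvariants.

(** * The reduction *)

Section PBounded.

Lemma horner_nat_mono (q : {poly nat}) a b : (a <= b)%N -> (q.[a] <= q.[b])%N.
Proof.
move=> ab; rewrite !horner_coef; apply: leq_sum => i _.
by apply: leq_mul => //; elim: (val i) => // e IH; rewrite !exprS; apply: leq_mul.
Qed.

Lemma p_bounded_leq t u : (forall n, t n <= u n)%N -> p_bounded u -> p_bounded t.
Proof. by move=> tu [q qu]; exists q => n; apply: leq_trans (tu n) (qu n). Qed.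

Lemma p_bounded_const c : p_bounded (fun=> c).
Proof. by exists c%:P => n; rewrite hornerC. Qed.

Lemma p_boundedD t u : p_bounded t -> p_bounded u -> p_bounded (fun n => t n + u n)%N.
Proof. by move=> [q tq] [r ur]; exists (q + r) => n; rewrite hornerD; apply: leq_add. Qed.

Lemma p_boundedM t u : p_bounded t -> p_bounded u -> p_bounded (fun n => t n * u n)%N.
Proof. by move=> [q tq] [r ur]; exists (q * r) => n; rewrite hornerM; apply: leq_mul. Qed.

Lemma p_bounded_comp (q : {poly nat}) t : p_bounded t -> p_bounded (fun n => q.[t n])%N.
Proof.
by move=> [r tr]; exists (q \Po r) => n; rewrite horner_comp; apply: horner_nat_mono.
Qed.

(** Bridges the real polynomial of the theorem and the natural one of [p_bounded]: each coefficient
    is replaced by a natural bound of its absolute value. *)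
Lemma nat_poly_majorant (R : realType) (q : {poly R}) : exists q' : {poly nat},
  forall n e : nat, e%:R <= q.[n%:R] -> (e <= q'.[n])%N.
Proof.
exists (\poly_(i < size q) Num.bound (q`_i)) => n e le.
rewrite -(ler_nat R); apply: le_trans le _; rewrite horner_poly horner_coef natr_sum.
apply: ler_sum => i _; rewrite natrM natrX; apply: ler_wpM2r; first exact: exprn_ge0.
exact/ltW/(le_lt_trans (ler_norm _))/unstable.ltr_norm_bound.
Qed.

End PBounded.

Section DegreeOfComposition.
Variables (K : comNzRingType) (n k : nat).

Lemma msize_leP m (P : {mpoly K[m]}) d :
  (forall mu, mu \in msupp P -> (mdeg mu < d)%N) -> (msize P <= d)%N.
Proof. by move=> h; rewrite msizeE; apply/bigmax_leqP_seq => mu /h. Qed.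

Lemma msize_mul_le (P Q : {mpoly K[k]}) d e :
  (msize P <= d.+1)%N -> (msize Q <= e.+1)%N -> (msize (P * Q) <= (d + e).+1)%N.
Proof.
move=> sP sQ; apply: msize_leP => mu /msuppM_le /allpairsP[[m1 m2] /= [h1 h2 ->]].
rewrite mdegD ltnS leq_add //; rewrite -ltnS.
  exact: leq_trans (msize_mdeg_lt h1) sP.
exact: leq_trans (msize_mdeg_lt h2) sQ.
Qed.

Lemma msize_comp_mpoly (p : {mpoly K[n]}) (lq : n.-tuple {mpoly K[k]}) :
  (forall i, (msize (tnth lq i) <= 2)%N) -> (msize (p \mPo lq) <= msize p)%N.
Proof.
move=> h; rewrite comp_mpolyE; apply: leq_trans (msize_sum _ _ _) _.
apply/bigmax_leqP_seq => mu muP _; apply: leq_trans (msize_mdeg_lt muP).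
apply: leq_trans (msizeZ_le _ _) _; rewrite mdegE.
elim/big_rec2: _ => [|i P e _ sP]; first by rewrite msize1.
apply: msize_mul_le => //.
elim: (mu i) => [|q IH]; first by rewrite expr0 msize1.
rewrite exprS -[q.+1 in leqRHS]add1n; apply: msize_mul_le => //; exact: h.
Qed.
End DegreeOfComposition.

Lemma mpoly_rmorph_id (K : comNzRingType) n (h : {rmorphism {mpoly K[n]} -> {mpoly K[n]}}) :
  (forall c, h c%:MP = c%:MP) -> (forall i, h 'X_i = 'X_i) -> forall p, h p = p.
Proof.
move=> hC hX p; rewrite {1}(mpolyE p) rmorph_sum [RHS]mpolyE; apply: eq_bigr => m _.
rewrite -!mul_mpolyC rmorphM hC; congr (_ * _).
by rewrite mpolyXE_id rmorph_prod; apply: eq_bigr => i _; rewrite rmorphXn hX.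
Qed.

Section RenameCircuit.
Variables (K : comNzRingType) (m m' : nat) (h : 'I_m -> 'I_m').

Definition rename_gate (g : gate K 'I_m) : gate K 'I_m' :=
  match g with
  | GVar x => GVar (h x) | GConst c => GConst c
  | GAdd i j => GAdd i j | GMul i j => GMul i j
  end.

Lemma rename_circuit (c : circuit K 'I_m) f : computes c f ->
  exists c' : circuit K 'I_m', num_gates c' = num_gates c /\
    computes c' (f \mPo [tuple 'X_(h i) | i < m]).
Proof.
move=> xcoef; case: c xcoef => gs ne wf xcoef.
have ne' : (0 < size (map rename_gate gs))%N by rewrite size_map.
have wf' : gates_wf 0 (map rename_gate gs).
  by elim: gs 0%N wf {ne ne' xcoef} => //= g gs IH pos /andP[wg /IH->]; rewrite andbT; case: g wg.
exists (Circuit ne' wf'); split; first by rewrite /num_gates /= size_map.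
rewrite /computes -xcoef.
pose rho : {rmorphism {mpoly K[m]} -> {mpoly K[m']}} := comp_mpoly [tuple 'X_(h i) | i < m].
have hC (a : K) : a%:MP = rho a%:MP by rewrite /rho /= comp_mpolyC.
have hX i : 'X_(h i) = rho 'X_i by rewrite /rho /= comp_mpolyXU -tnth_nth tnth_mktuple.
have := circuit_eval_morph (Circuit ne wf) hC hX; rewrite /rho /= => ->.
rewrite /circuit_eval /=; congr (last _ _).
elim/last_ind: gs {ne wf xcoef ne' wf'} => // gs g IH.
by rewrite map_rcons !gate_values_rcons IH; congr rcons; case: g.
Qed.
End RenameCircuit.

(** With no bits the exponential sum has the single empty assignment; the circuits are only renamed
    into [nvars f n + 0] variables. *)
Lemma VP_sub_VNP (K : comNzRingType) (f : poly_family K) : VP f -> VNP f.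
Proof.
move=> [bn bd [c [bc xcoef]]].
pose lq n := [tuple ('X_(lshift 0 i) : {mpoly K[nvars f n + 0]}) | i < nvars f n].
exists (fun=> 0%N), (fun n => f n \mPo lq n); split.
- exact: p_bounded_const.
- split=> /=.
  + by apply: p_bounded_leq bn => n; rewrite addn0.
  + apply: p_bounded_leq bd => n; rewrite -!subn1; apply: leq_sub2r.
    by apply: msize_comp_mpoly => i; rewrite tnth_mktuple msizeX mdeg1.
  + have H n := rename_circuit (lshift 0 : 'I_(nvars f n) -> 'I_(nvars f n + 0)) (xcoef n).
    exists (fun n => sval (boolp.cid (H n))); split.
      by apply: p_bounded_leq bc => n; have [-> _] := svalP (boolp.cid (H n)).
    by move=> n; have [_ h] := svalP (boolp.cid (H n)).
- move=> n; pose e0 : {ffun 'I_0 -> bool} := [ffun=> false].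
  rewrite (big_pred1 e0) => [|e]; last by apply/esym/eqP/ffunP => -[].
  apply/esym; rewrite /subst_bits.
  set l2 := (X in _ \mPo X).
  pose h : {rmorphism {mpoly K[nvars f n]} -> {mpoly K[nvars f n]}} :=
    comp_mpoly l2 \o comp_mpoly (lq n).
  apply: (@mpoly_rmorph_id K _ h) => [a|i] /=; first by rewrite !comp_mpolyC.
  rewrite comp_mpolyXU -tnth_nth tnth_mktuple comp_mpolyXU -tnth_nth tnth_mktuple.
  by have := unsplitK (inl i : 'I_(nvars f n) + 'I_0); rewrite /= => ->.
Qed.

Section Reduction.
Variables (R : realType) (k : nat).
Notation K := (R[i] : numClosedFieldType).
Hypothesis k_gt0 : (0 < k)%N.
Hypothesis k_even : ~~ odd k.

(** Three costs add up: the [N * N] affine entries, the truncated evaluation of the encoding circuit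
    at a generator with [kappa != 0], and two gates that rescale by [a / kappa]. *)
Lemma permanent_slp (N r S m : nat)
    (c : circuit rat ('I_(tensor_dim (2 * k) (2 * k * N)) + 'I_r))
    (X : 'I_N -> 'I_N -> {mpoly K[m]}) (a : K) :
  (0 < N)%N -> succinctly_encodes c (@SL_invariant K (2 * k) (2 * k * N)) ->
  (num_gates c <= S)%N -> (forall i j, (msize (X i j) <= 2)%N) ->
  exists c' : circuit K 'I_m,
    (num_gates c' <= N * N * (3 + 4 * m) + S * (N.+1 * (2 * N + 3)) + 2)%N /\
    computes c' (a%:MP * permanent X).
Proof.
move=> N0 enc szc affX.
have [f [alpha fE] kappa0] := exists_generator_with_perm_term k_gt0 k_even N0 enc.
have finv : @SL_invariant K (2 * k) (2 * k * N) f.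
  by apply/enc/gen_incl; exists alpha.
set kappa := _@__ in kappa0.
pose ts := [seq X i j | i <- enum 'I_N, j <- enum 'I_N].
have [|//|L0 [sL0 _ tsL0 zL0]] := @reach_all _ (@slp K m) [::] (3 + 4 * m) ts _ [::] (@slp_nil K m).
  by move=> x /allpairsP[[i j] /= [_ _ ->]]; apply: reachs_affine.
have sts : size ts = (N * N)%N by rewrite size_allpairs !size_enum_ord.
pose const (b : rat) : {mpoly K[m]} := (ratr b)%:MP.
pose env (z : 'I_(tensor_dim (2 * k) (2 * k * N)) + 'I_r) : {poly {mpoly K[m]}} :=
  match z with inl q => graded_env X (enum_val q) | inr j => ((alpha j)%:MP)%:P end.
have const_const b : exists c0, const b = c0%:MP by exists (ratr b).
have zero_reach : reach (@slp K m) L0 1 0.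
  by rewrite -(@mpolyC0 m K); apply: reachs_const.
have env_reach z d : (d <= N)%N -> reach (@slp K m) L0 1 (env z)`_d.
  move=> _; case: z => [q|j] /=; last first.
    by rewrite coefC; case: eqP => _ //; apply: reachs_const.
  rewrite /graded_env coefMX coefC; case: d => [|[|d]] //=.
  have [[i [j ->]]|out] := mx_tensor_cases (enum_val q); last by rewrite mx_tensor0.
  rewrite (mx_tensorE k_gt0); apply: (@reach_leq _ _ _ 0) => //; apply: reach_mem.
  by apply: tsL0; apply/allpairsP; exists (i, j); rewrite !mem_enum.
have [L1 [sL1 zL1 mL1]] := slp_circuit_coefficient const_const env_reach c sL0.
have coefE : (circuit_eval (fun b => (const b)%:P) env c)`_N = kappa%:MP * permanent X.
  rewrite -(graded_coefficient k_gt0 k_even N0 X finv) fE; apply/esym.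
  pose pm : {rmorphism K -> {poly {mpoly K[m]}}} := (@polyC {mpoly K[m]}) \o (@mpolyC m K).
  pose psi : {rmorphism {mpoly K[tensor_dim (2 * k) (2 * k * N)]} -> {poly {mpoly K[m]}}} :=
    mmap pm (fun z => graded_env X (enum_val z)).
  have hC (b : rat) : (const b)%:P = psi (ratr b)%:MP by rewrite /psi /= mmapC.
  have hX z : env z = psi (match z with inl i => 'X_i | inr j => (alpha j)%:MP end).
    by case: z => [z|j]; rewrite /psi /= ?mmapC // mmapX mmap1U.
  by rewrite -(circuit_eval_morph c hC hX).
have : reach (@slp K m) L1 2 (a%:MP * permanent X).
  have -> : a%:MP * permanent X = (a / kappa)%:MP * (kappa%:MP * permanent X).
    by rewrite mulrA -mpolyCM divfK.
  by apply: (@reachs_mul _ _ _ 1 0); [apply: reachs_const|apply: reach_mem; rewrite -coefE].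
case/(_ L1 sL1 (fun _ h => h)) => L2 [sL2 _ mL2 zL2].
have [c' [zc' cc']] := circuit_of_slp sL2 mL2.
exists c'; split=> //; apply: leq_trans zc' (leq_trans zL2 _); rewrite leq_add2r.
apply: leq_trans zL1 _; apply: leq_add; last by apply: leq_mul.
by apply: leq_trans zL0 _; rewrite /= sts.
Qed.

Lemma VNP_sub_VP (q : {poly nat}) (f : poly_family K) :
  (forall n : nat, (1 <= n)%N ->
     exists (r : nat) (c : circuit rat ('I_(tensor_dim (2 * k) (2 * k * n)) + 'I_r)),
       succinctly_encodes c (@SL_invariant K (2 * k) (2 * k * n)) /\
       (num_gates c <= q.[n])%N) ->
  VNP f -> VP f.
Proof.
move=> oracle [t [g [bt [/= bn bd [gcoef [bcg cgE]]] fE]]].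
have bm : p_bounded (nvars f) by apply: p_bounded_leq bn => n; apply: leq_addr.
pose D n := (msize (g n)).-1.
pose s n := (num_gates (gcoef n) * (D n * (2 * D n + 1)))%N.
pose N n := (1 + 2 * t n * (D n).+1 + 22 * s n * (D n).+1)%N.
pose S n := (N n * N n * (3 + 4 * nvars f n) + q.[N n] * ((N n).+1 * (2 * N n + 3)) + 2)%N.
have pc := p_bounded_const.
have bD1 : p_bounded (fun n => (D n).+1).
  by apply: p_bounded_leq (p_boundedD (p_bounded_const 1) bd) => n; rewrite add1n.
have bs : p_bounded s by apply: p_boundedM => //; apply: p_boundedM => //; apply: p_boundedD => //; apply: p_boundedM.
have bN : p_bounded N.
  apply: p_boundedD; first by apply: p_boundedD => //; do 2 apply: p_boundedM => //.
  by do 2 apply: p_boundedM => //.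
have bS : p_bounded S.
  apply: p_boundedD => //; apply: p_boundedD; first by apply: p_boundedM; [apply: p_boundedM|apply: p_boundedD => //; apply: p_boundedM].
  apply: p_boundedM; first exact: p_bounded_comp.
  apply: p_boundedM; last by apply: p_boundedD => //; apply: p_boundedM.
  by apply: p_bounded_leq (p_boundedD (p_bounded_const 1) bN) => n; rewrite add1n.
split=> //.
- apply: p_bounded_leq bd => n; rewrite -!subn1; apply: leq_sub2r; rewrite fE.
  apply: leq_trans (msize_sum _ _ _) _; apply/bigmax_leqP_seq => e _ _.
  apply: msize_comp_mpoly => i; rewrite tnth_mktuple; case: (split i) => j.
    by rewrite msizeX mdeg1.
  by case: (e j); rewrite ?msize1 ?msize0.
have H n : exists c : circuit K 'I_(nvars f n), (num_gates c <= S n)%N /\ computes c (f n).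
  have szg : (msize (g n) <= (D n).+1)%N by apply: leqSpred.
  have [L [outs [c0 [wL sL oL gE]]]] := wtrace_of_circuit (cgE n) szg.
  have [N' [X [a [/andP[N0 NN] affX aE]]]] := exponential_sum_permanent wL c0 oL.
  (* The encoding is used at the size [N'] of the permanent, which is positive and polynomially
     bounded in [n]. *)
  have [r [c [enc szc]]] := oracle N' N0.
  have [c' [zc' cc']] := permanent_slp a N0 enc szc affX.
  have NN' : (N' <= N n)%N.
    by apply: leq_trans NN _; rewrite leq_add2l leq_mul2r leq_mul2l sL !orbT.
  exists c'; split.
    apply: leq_trans zc' _; rewrite leq_add2r; apply: leq_add.
      by rewrite leq_mul2r leq_mul // orbT.
    apply: leq_mul; first exact: horner_nat_mono.
    by apply: leq_mul => //; rewrite leq_add2r leq_mul2l NN' orbT.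
  by rewrite fE gE aE.
exists (fun n => sval (boolp.cid (H n))); split.
  by apply: p_bounded_leq bS => n; have [h _] := svalP (boolp.cid (H n)).
by move=> n; have [_ h] := svalP (boolp.cid (H n)).
Qed.

End Reduction.

Theorem theorem1p11 (R : realType) (k : nat) (hk2 : (2 <= k)%N)
    (hk : ~~ odd k)
    (VP_neq_VNP : ~ (forall f : poly_family R[i], VP f <-> VNP f)) :
  ~ (exists q : {poly R}, forall n : nat, (1 <= n)%N ->
       exists (r : nat)
              (c : circuit rat
                     ('I_(tensor_dim (2 * k) (2 * k * n)) + 'I_r)),
         succinctly_encodes c
           (@SL_invariant R[i] (2 * k) (2 * k * n)) /\
         (encoding_size c)%:R <= q.[n%:R]).
Proof.
(* The inequality of classes is refuted by proving both inclusions for every family. *)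
move=> [q qP]; apply: VP_neq_VNP => f; split; first exact: VP_sub_VNP.
have [q' q'P] := nat_poly_majorant q.
apply: (@VNP_sub_VP R k _ hk q'); first exact: ltnW.
move=> n n1; have [r [c [enc sz]]] := qP n n1; exists r, c; split=> //.
by apply: leq_trans (q'P _ _ sz); apply: leq_addr.
Qed.
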